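(* Let $G$ be a second countable, locally compact, abelian group with Haar measure $m$, dual group $\widehat{G}$ with Plancherel measure $\mu$, and let $G_0$ be the identity component of $G$. Then the qualitative uncertainty principle (QUP) for the Gabor transform holds on $G$, i.e. for every $f\in L^2(G)$ and every window function $\psi$ on $G$, $$(m\times\mu)\big(\{(x,\gamma)\in G\times\widehat{G} : G_\psi f(x,\gamma)\neq 0\}\big)<\infty \ \Longrightarrow\ f=0 \text{ a.e.},$$ if and only if $G_0$ is non-compact.
   Context: A window function on $G$ is a non-zero element $\psi\in L^2(G)$. For $f\in L^2(G)$ and a window function $\psi$, the Gabor transform of $f$ with respect to $\psi$ is the function $G_\psi f:G\times\widehat{G}\to\mathbb{C}$, $G_\psi f(x,\gamma)=\int_G f(y)\,\overline{\psi(x^{-1}y)}\,\gamma(y^{-1})\,dm(y)$. The Plancherel measure $\mu$ on $\widehat{G}$ is the Haar measure on $\widehat{G}$ for which the Fourier transform $\widehat{f}(\gamma)=\int_G f(y)\gamma(y^{-1})\,dm(y)$ extends to a unitary map $L^2(G,m)\to L^2(\widehat{G},\mu)$. *)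

(* Defs.v *)
From HB Require Import structures.
From mathcomp Require Import all_boot all_order all_algebra.
From mathcomp Require Import all_classical all_reals all_analysis.
From mathcomp Require Import complex.

Set Implicit Arguments.
Unset Strict Implicit.
Unset Printing Implicit Defensive.

Import Order.TTheory GRing.Theory Num.Theory.
Import numFieldTopology.Exports.

Local Open Scope classical_set_scope.
Local Open Scope ring_scope.

(** Abelian groups are written additively ([topologicalZmodType]): [- x + y]
    stands for x^{-1}y and [0] for the identity element.  The dual group is
    additive too: [+] is the pointwise product of characters. *)

(** The library's [g_sigma_algebraType] needs a pointed type, which
    [topologicalZmodType] is not. *)
Definition pointed0 (G : topologicalZmodType) : Type := G.

HB.instance Definition _ (G : topologicalZmodType) := Choice.on (pointed0 G).
HB.instance Definition _ (G : topologicalZmodType) :=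
  isPointed.Build (pointed0 G) (0 : G).

Definition borel (G : topologicalZmodType) : Type :=
  g_sigma_algebraType (@open G : set (set (pointed0 G))).

HB.instance Definition _ (G : topologicalZmodType) :=
  Measurable.on (borel G).

Section Haar.
Context {R : realType} {G : topologicalZmodType}.
Local Open Scope ereal_scope.

Definition haar_measure (m : {measure set (borel G) -> \bar R}) : Prop :=
  [/\ m setT != 0,
      forall K : set G, compact K -> m K < +oo,
      forall A : set (borel G), measurable A ->
        m A = ereal_inf [set m U | U in [set U : set G | open U /\ A `<=` U]],
      forall U : set G, open U ->
        m U = ereal_sup [set m K | K in [set K : set G | compact K /\ K `<=` U]]
    & forall (x : G) (A : set (borel G)), measurable A ->
        m [set (x + a)%R | a in (A : set G)] = m A].

End Haar.

Section ComplexIntegration.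
Context {d : measure_display} {T : measurableType d} {R : realType}.
Variable m : {measure set T -> \bar R}.

Definition cmeasurable (f : T -> R[i]) : Prop :=
  measurable_fun setT (fun x => complex.Re (f x)) /\
  measurable_fun setT (fun x => complex.Im (f x)).

Definition cintegral (f : T -> R[i]) : R[i] :=
  Complex (\int[m]_x complex.Re (f x)) (\int[m]_x complex.Im (f x)).

Definition L1 (f : T -> R[i]) : Prop :=
  cmeasurable f /\
  (\int[m]_x (ComplexField.Normc.normc (f x))%:E < +oo)%E.

Definition L2 (f : T -> R[i]) : Prop :=
  cmeasurable f /\
  (\int[m]_x (ComplexField.Normc.normc (f x) ^+ 2)%:E < +oo)%E.

Definition L2dot (f g : T -> R[i]) : R[i] :=
  cintegral (fun x => f x * conjc (g x)).

End ComplexIntegration.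

(** The dual group, with the compact-open topology below. *)
Record character (R : realType) (G : topologicalZmodType) := Character {
  character_fun :> G -> R[i];
  character_continuous : continuous (character_fun : G -> R[i]^o);
  characterD : forall x y : G,
    character_fun (x + y) = character_fun x * character_fun y;
  character_norm : forall x : G, `|character_fun x| = 1
}.

Section DualGroup.
Context {R : realType} {G : topologicalZmodType}.
Implicit Types c : character R G.

Lemma character_inj c1 c2 : (c1 : G -> R[i]) =1 c2 -> c1 = c2.
Proof.
case: c1 c2 => [f fc fD fn] [g gc gD gn] /= /funext fg.
by subst g; congr Character; exact: Prop_irrelevance.
Qed.

Lemma character_neq0 c x : c x != 0.
Proof. by rewrite -normr_eq0 character_norm oner_eq0. Qed.

HB.instance Definition _ := gen_eqMixin (character R G).
HB.instance Definition _ := gen_choiceMixin (character R G).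


Let one_continuous : continuous ((fun=> 1) : G -> R[i]^o).
Proof. by move=> x; exact: cvg_cst. Qed.

Let one_morph (x y : G) : 1 = 1 * 1 :> R[i].
Proof. by rewrite mulr1. Qed.

Let one_norm (x : G) : `|1 : R[i]| = 1.
Proof. by rewrite normr1. Qed.

Definition character1 : character R G :=
  Character one_continuous one_morph one_norm.

Let mul_continuous c1 c2 : continuous ((fun x => c1 x * c2 x) : G -> R[i]^o).
Proof.
move=> x; apply: (@cvgM R[i] G (nbhs x) _ (c1 : G -> R[i]^o)
  (c2 : G -> R[i]^o)); exact: character_continuous.
Qed.

Let mul_morph c1 c2 x y :
  c1 (x + y) * c2 (x + y) = (c1 x * c2 x) * (c1 y * c2 y).
Proof. by rewrite !characterD mulrACA. Qed.

Let mul_norm c1 c2 x : `|c1 x * c2 x| = 1.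
Proof. by rewrite normrM !character_norm mulr1. Qed.

Definition characterM c1 c2 : character R G :=
  Character (@mul_continuous c1 c2) (@mul_morph c1 c2) (@mul_norm c1 c2).

Let inv_continuous c : continuous ((fun x => (c x)^-1) : G -> R[i]^o).
Proof.
move=> x; apply: (@cvgV R[i] G (nbhs x) _ (c : G -> R[i]^o)).
  exact: character_neq0.
exact: character_continuous.
Qed.

Let inv_morph c x y : (c (x + y))^-1 = (c x)^-1 * (c y)^-1.
Proof. by rewrite characterD invfM. Qed.

Let inv_norm c x : `|(c x)^-1| = 1.
Proof. by rewrite normfV character_norm invr1. Qed.

Definition characterV c : character R G :=
  Character (@inv_continuous c) (@inv_morph c) (@inv_norm c).

Let characterMA : associative characterM.
Proof. by move=> a b c; apply: character_inj => x /=; rewrite mulrA. Qed.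

Let characterMC : commutative characterM.
Proof. by move=> a b; apply: character_inj => x /=; rewrite mulrC. Qed.

Let character1M : left_id character1 characterM.
Proof. by move=> a; apply: character_inj => x /=; rewrite mul1r. Qed.

Let characterVM : left_inverse character1 characterV characterM.
Proof.
by move=> a; apply: character_inj => x /=; rewrite mulVf// character_neq0.
Qed.

HB.instance Definition _ := GRing.isZmodule.Build (character R G)
  characterMA characterMC character1M characterVM.

HB.instance Definition _ := Topological.copy (character R G)
  (initial_topology (fun c => (c : G -> R[i]^o) : {compact-open, G -> R[i]^o})).

Lemma nbhs_characterP (c : character R G) (A : set (character R G)) :
  nbhs c A <-> exists K : set G, exists e : R[i],
    [/\ compact K, 0 < e &
      [set c' : character R G | forall x, K x -> `|c x - c' x| < e] `<=` A].
Proof.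
pose V : puniformType := R[i]^o.
pose N (Ke : set G * R[i]) : set (G -> V) :=
  [set g : G -> V | forall x, Ke.1 x -> `|c x - g x| < Ke.2].
pose D := [set Ke : set G * R[i] | compact Ke.1 /\ 0 < Ke.2].
pose F : set_system (G -> V) := filter_from D N.
have FF : Filter F.
  apply: filter_from_filter; first by exists (set0, 1); split => //; exact: compact0.
  move=> [K d] [L e] [/= cK d0] [/= cL e0].
  have [f f0 fde] : exists2 f, 0 < f & f <= d /\ f <= e.
    have de : d >=< e by rewrite real_comparable// gtr0_real.
    exists (Num.min d e); first by rewrite comparable_lt_min// d0 e0.
    by rewrite !comparable_ge_min// !lexx orbT.
  exists (K `|` L, f) => [|g /= gKL]; first by split => //; exact: compactU.
  by split=> x /= Kx; apply: (lt_le_trans (gKL _ _)); [left| |right|]; tauto.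
have cc : continuous (c : G -> V) by exact: character_continuous.
split=> [|[K [e [cK e0 KA]]]].
  rewrite nbhsE /= => -[_ [[B oB <-] Bc] BA].
  have FcV : {compact-open, F --> (c : G -> V)}.
    apply/compact_open_fam_compactP => //; apply/fam_cvgP => K cK P.
    move=> /uniform_nbhs[E [+ EP]]; rewrite -entourage_ballE => -[e e0 eE].
    exists (K, e); first by split.
    by move=> g /= gK; apply: EP => y Ky; apply: eE; exact: gK.
  have [] := FcV B; first exact: open_nbhs_nbhs.
  move=> [K e] [cK e0] NB; exists K, e; split => // c' c'K.
  by apply: BA; exact: NB.
have cnF : nbhs (c : {compact-open, G -> V}) (N (K, e)).
  have : {family compact, nbhs (c : {compact-open, G -> V}) --> (c : G -> V)}.
    by apply/compact_open_fam_compactP.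
  move=> /fam_cvgP/(_ K cK); apply; apply/uniform_nbhs.
  exists [set xy : V * V | ball xy.1 e xy.2]; split.
    by rewrite -entourage_ballE; exists e.
  by move=> g gK x /gK.
have cnA : nbhs c [set c' : character R G | N (K, e) c'].
  exact: (@initial_continuous _ _
    (fun c : character R G => (c : {compact-open, G -> V})) c _ cnF).
by apply: filterS cnA => c' c'K; exact: KA.
Qed.

Let character_add_continuous :
  continuous (fun c : character R G * character R G => c.1 + c.2).
Proof.
move=> [a b] A /nbhs_characterP[K [e [cK e0 KA]]].
pose N (c : character R G) :=
  [set c' : character R G | forall x, K x -> `|c x - c' x| < e / 2].
have nN c : nbhs c (N c).
  by apply/nbhs_characterP; exists K, (e / 2); split => //; rewrite divr_gt0.
exists (N a, N b) => [|[a' b'] /= [aa' bb']]; first by split; exact: nN.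
apply: KA => x Kx /=.
have -> : a x * b x - a' x * b' x = (a x - a' x) * b x + a' x * (b x - b' x).
  by rewrite mulrBl mulrBr addrA subrK.
rewrite (le_lt_trans (ler_normD _ _))// !normrM !character_norm mul1r mulr1.
by rewrite [e]splitr ltrD// ?aa'// bb'.
Qed.

Let character_opp_continuous : continuous (-%R : character R G -> character R G).
Proof.
move=> a A /nbhs_characterP[K [e [cK e0 KA]]].
apply/nbhs_characterP; exists K, e; split => // a' aa'; apply: KA => x Kx /=.
have -> : (a x)^-1 - (a' x)^-1 = (a' x - a x) * ((a x)^-1 * (a' x)^-1).
  rewrite mulrBl mulrCA divff ?character_neq0// mulr1.
  by rewrite mulrA divff ?character_neq0// mul1r.
by rewrite !normrM !normfV !character_norm invr1 !mulr1 distrC aa'.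
Qed.

HB.instance Definition _ := PreTopologicalNmodule_isTopologicalNmodule.Build
  (character R G) character_add_continuous.
HB.instance Definition _ := TopologicalNmodule_isTopologicalZmodule.Build
  (character R G) character_opp_continuous.

End DualGroup.

Section Fourier.
Context {R : realType} {G : topologicalZmodType}.
Variables (m : {measure set (borel G) -> \bar R})
  (mu : {measure set (borel (character R G)) -> \bar R}).

Definition fourier (f : borel G -> R[i]) (c : borel (character R G)) : R[i] :=
  cintegral m (fun y => f y * (c : character R G) (- (y : G))).

(** [U] acts on functions; [plancherel_linear] and [plancherel_dot] force it
    to respect almost everywhere equality, so it is a unitary map between the
    Hilbert spaces of classes. *)
Record plancherel_extension
    (U : (borel G -> R[i]) -> (borel (character R G) -> R[i])) : Prop := {
  plancherel_L2 : forall f, L2 m f -> L2 mu (U f);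
  plancherel_linear : forall (a : R[i]) f g, L2 m f -> L2 m g ->
    ae_eq mu setT (U (fun x => a * f x + g x)) (fun c => a * U f c + U g c);
  plancherel_dot : forall f g, L2 m f -> L2 m g ->
    L2dot mu (U f) (U g) = L2dot m f g;
  plancherel_surj : forall h, L2 mu h ->
    exists2 f, L2 m f & ae_eq mu setT (U f) h;
  plancherel_fourier : forall f, L1 m f -> L2 m f ->
    ae_eq mu setT (U f) (fourier f)
}.

Definition plancherel_measure : Prop :=
  haar_measure mu /\ exists U, plancherel_extension U.

Definition window (psi : borel G -> R[i]) : Prop :=
  L2 m psi /\ ~ ae_eq m setT psi (cst 0).

Definition gabor (psi f : borel G -> R[i])
    (x : borel G) (c : borel (character R G)) : R[i] :=
  cintegral m (fun y => f y * conjc (psi (- (x : G) + (y : G))) *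
                        (c : character R G) (- (y : G))).

(** For second countable [G] the product of the two Borel sigma-algebras is
    the Borel sigma-algebra of the product, and Haar measures are
    sigma-finite. *)
Definition gabor_qup : Prop :=
  forall f psi : borel G -> R[i], L2 m f -> window psi ->
    ((m \x mu) [set z | gabor psi f z.1 z.2 != 0%R] < +oo)%E ->
    ae_eq m setT f (cst 0).

End Fourier.

Definition identity_component (G : topologicalZmodType) : set G :=
  connected_component [set: G] 0.

Arguments identity_component : clear implicits.

(* Main.v *)
Require Import Defs.
From HB Require Import structures.
From mathcomp Require Import all_boot all_order all_algebra.
From mathcomp Require Import all_classical all_reals all_analysis.
From mathcomp Require Import measurable_realfun measurable_fun_approximation simple_functions.
From mathcomp Require Import complex ring lra.

(** The Gabor transform of [f] at [(x, c)] is the inner product of [f] with the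
    time-frequency shift [atom psi x c] of the window.

    Noncompact identity component.  Suppose that the support [S] of the transform
    of a nonnull [f] has finite measure.  Two facts contradict each other for large [k], as in
    the Amrein-Berthier proof of the uncertainty principle for the Fourier
    transform.

    - If [k] orthonormal signals have their transforms supported in one set [A],
      then [k] is at most the measure of [A] ([gabor_support_bound]).  By Bessel's
      inequality the squared moduli of the [k] transforms add up to at most
      [|psi|^2] at every point of [A], while by Plancherel on [G] and Tonelli on
      [G x G] each of them has integral [|psi|^2] ([gabor_energy_at],
      [energy_total]).

    - For every [k] there are [k] orthonormal signals supported in this sense in a
      set of measure less than that of [S] plus 1 ([orthonormal_family]).  They
      are combinations of translates of [f]; translating [f] by [t] translates [S]
      by [(t, 0)].
      The overlap of [S + (t, 0)] with a set containing [S] is continuous in [t],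
      is total at [t = 0], and is partial for some [t] in the identity component,
      which is not compact.  As the component is connected, the overlap falls short
      of being total by an arbitrarily small positive amount
      ([small_positive_escape]): the new translate enlarges the support by little,
      and by enough to be linearly independent of the previous ones.

    The transform is jointly continuous ([gabor_near]), so [S] and all the sets
    built from it are open; the measure of their sections is then lower
    semicontinuous by inner regularity, which takes care of measurability and of
    the continuity of the overlap.

    Compact identity component.  Then [G] has a compact open subgroup [K]
    ([compact_open_subgroup]).  The transform of the indicator of [K] with respect
    to itself is supported in the product of [K] with the annihilator of [K], and
    this product has finite measure ([not_gabor_qup]). *)

Set Implicit Arguments.
Unset Strict Implicit.
Unset Printing Implicit Defensive.

Import Order.TTheory GRing.Theory Num.Theory.
Import numFieldTopology.Exports.

Local Open Scope classical_set_scope.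
Local Open Scope ring_scope.

(** * Topological groups and their identity component *)

Section TopologicalGroup.
Variable G : topologicalZmodType.
Implicit Types (A B K V W : set G) (x y z : G).

Lemma translation_continuous x : continuous (fun y : G => x + y).
Proof.
move=> y; apply: (@continuous_comp _ _ _ (fun y => (x, y))
  (fun z : G * G => z.1 + z.2)); last exact: add_continuous.
by apply: cvg_pair => /=; [exact: cvg_cst|exact: cvg_id].
Qed.

Lemma reflection_continuous x : continuous (fun y : G => x - y).
Proof.
move=> y; apply: (@continuous_comp _ _ _ (fun y => (x, y))
  (fun z : G * G => z.1 - z.2)); last exact: sub_continuous.
by apply: cvg_pair => /=; [exact: cvg_cst|exact: cvg_id].
Qed.

Lemma translation_image x A : [set x + a | a in A] = [set y | A (- x + y)].
Proof.
rewrite eqEsubset; split=> [_ [a Aa <-] /=|y /= Ay]; first by rewrite addKr.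
by exists (- x + y) => //; rewrite addNKr.
Qed.

Lemma open_translation x A : open A -> open [set x + a | a in A].
Proof.
move=> oA; rewrite translation_image.
exact: (open_comp (fun y _ => @translation_continuous (- x) y) oA).
Qed.

Lemma compactB A B : compact A -> compact B ->
  compact [set z | exists2 a, A a & exists2 b, B b & z = a - b].
Proof.
move=> cA cB.
rewrite (_ : mkset _ = (fun z : G * G => z.1 - z.2) @` (A `*` B)).
  apply: continuous_compact; last exact: compact_setX.
  by apply: continuous_subspaceT; exact: sub_continuous.
rewrite eqEsubset; split=> [_ [a Aa [b Bb ->]]|_ [[a b] [/= Aa Bb] <-]].
  by exists (a, b).
by exists a => //; exists b.
Qed.

(** The difference [a - b] stays away from [0] on [A * B], uniformly by
    compactness, so small neighbourhoods of [A] and [B] remain disjoint. *)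
Lemma compact_separation A B : hausdorff_space G -> compact A -> compact B ->
  A `&` B = set0 ->
  exists U V : set G, [/\ open U, open V, A `<=` U, B `<=` V & U `&` V = set0].
Proof.
move=> hG cA cB AB0.
have o0 : open (~` [set (0 : G)]).
  exact/closed_openC/accessible_closed_set1/hausdorff_accessible.
have /compact_near_coveringP := compact_setX cA cB.
move=> /(_ (G * G)%type (nbhs ((0 : G), (0 : G)))
  (fun n d => (d.1 + n.1) - (d.2 + n.2) <> 0))[].
  move=> [a b] [/= Aa Bb].
  pose f (z : (G * G) * (G * G)) := (z.1.1 + z.2.1) - (z.1.2 + z.2.2).
  have cf : continuous f.
    have cadd (g h : (G * G) * (G * G) -> G) : continuous g -> continuous h ->
        continuous (fun w => g w + h w).
      move=> cg ch w; apply: (@continuous_comp _ _ _ (fun w => (g w, h w))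
        (fun z : G * G => z.1 + z.2)); last exact: add_continuous.
      by apply: cvg_pair; [exact: cg|exact: ch].
    apply: (cadd (fun w => w.1.1 + w.2.1) (fun w => - (w.1.2 + w.2.2))).
      apply: (cadd (fun w => w.1.1) (fun w => w.2.1)) => w.
        by apply: (@continuous_comp _ _ _ fst fst); exact: cvg_fst.
      apply: (@continuous_comp _ _ _ snd fst); [exact: cvg_snd|exact: cvg_fst].
    move=> w; apply: (@continuous_comp _ _ _ (fun w => w.1.2 + w.2.2) -%R);
      last exact: opp_continuous.
    apply: (cadd (fun w => w.1.2) (fun w => w.2.2)) => {}w; last by apply: (@continuous_comp _ _ _ snd snd); exact: cvg_snd.
    apply: (@continuous_comp _ _ _ fst snd); [exact: cvg_fst|exact: cvg_snd].
  have fab : (~` [set (0 : G)]) (f ((a, b), (0, 0))).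
    rewrite /f /= !addr0 => /eqP; rewrite subr_eq0 => /eqP ab.
    by suff : set0 a by []; rewrite -AB0; split => //; rewrite ab.
  exact: (cf ((a, b), (0, 0)) _ (open_nbhs_nbhs (conj o0 fab))).
move=> [N1 N2] /= [nN1 nN2] N12.
exists (\bigcup_(n in N1°) [set n + a | a in A]).
exists (\bigcup_(n in N2°) [set n + a | a in B]).
have N1o : N1° `<=` N1 by exact: interior_subset.
have N2o : N2° `<=` N2 by exact: interior_subset.
have oU (N C : set G) : open (\bigcup_(n in N°) [set n + a | a in C]).
  rewrite (_ : \bigcup_(n in N°) _ = \bigcup_(a in C) [set a + n | n in N°]).
    by apply: bigcup_open => a _; apply: open_translation; exact: open_interior.
  rewrite eqEsubset; split=> z [u Hu [v Hv <-]]; exists v => //; exists u => //;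
    exact: addrC.
split.
- exact: oU.
- exact: oU.
- by move=> a Aa; exists 0; [exact: nN1|exists a => //; rewrite add0r].
- by move=> a Aa; exists 0; [exact: nN2|exists a => //; rewrite add0r].
- rewrite -subset0 => z [[n1 Hn1 [a Aa az]] [n2 Hn2 [b Bb bz]]].
  have /= := N12 (n1, n2) (conj (N1o _ Hn1) (N2o _ Hn2)) (a, b) (conj Aa Bb).
  by rewrite (addrC a) az (addrC b) bz subrr.
Qed.

(** In a compact Hausdorff set the quasi-component of a point, that is the
    intersection of its clopen neighbourhoods, is connected: a splitting of it
    would extend, by separation and compactness, to one of these neighbourhoods.
    So it is contained in the component, and compactness again puts one of the
    clopen neighbourhoods inside [W]. *)
Lemma component_clopen_basis B x W : hausdorff_space G -> compact B -> B x ->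
  open W -> connected_component B x `<=` W ->
  exists V, [/\ V x, V `<=` B, closed V, V `<=` W &
    exists2 O, open O & V = B `&` O].
Proof.
move=> hG cB Bx oW CW.
have clB : closed B by exact: compact_closed.
pose cl (V : set G) :=
  [/\ V x, V `<=` B, closed V & exists2 O, open O & V = B `&` O].
have clI V V' : cl V -> cl V' -> cl (V `&` V').
  move=> [Vx VB cV [P oP VP]] [V'x V'B cV' [P' oP' VP']]; split => //.
  - by move=> y [Vy _]; exact: VB.
  - exact: closedI.
  - exists (P `&` P'); first exact: openI.
    by rewrite VP VP' setIACA setIid.
have clBB : cl B by split => //; exists setT; [exact: openT|rewrite setIT].
pose F : set_system (set G) := filter_from cl (fun V => [set V' | cl V' /\ V' `<=` V]).
have FF : Filter F.
  apply: filter_from_filter; first by exists B.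
  move=> V V' clV clV'; exists (V `&` V'); first exact: clI.
  by move=> U [clU UVV']; split; split=> // y /UVV' [].
(* the family [cl] is directed, so compactness replaces its intersection by one
   of its members *)
have small O : open O -> (\bigcap_(V in cl) V) `<=` O ->
    exists2 V, cl V & V `<=` O.
  move=> oO QO.
  have cBO : compact (B `\` O).
    apply: (subclosed_compact _ cB); last by move=> y [].
    by apply: closedI => //; exact: open_closedC.
  have /compact_near_coveringP/(_ _ F (fun V y => ~ V y) FF)[|V clV VO] := cBO.
    move=> y [By Oy].
    have [V clV Vy] : exists2 V, cl V & ~ V y.
      apply: contrapT => /forall2NP nV; apply: Oy; apply: QO => V clV.
      by have [//|/contrapT] := nV V.
    exists (~` V, [set V' | cl V' /\ V' `<=` V]) => /=.
      split; last by exists V.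
      by apply: open_nbhs_nbhs; split => //; apply: closed_openC; case: clV.
    by move=> [y' V'] /= [Vy' [_ V'V]] /V'V.
  exists V => // y Vy; apply: contrapT => Oy.
  apply: (VO V _ y _ Vy); first by split.
  by split => //; case: clV => _ /(_ _ Vy).
set Q := \bigcap_(V in cl) V.
have Qx : Q x by move=> V [].
have QB : Q `<=` B by move=> y /(_ B clBB).
have clQ : closed Q by apply: closed_bigI => V [].
have conQ : connected Q.
  move=> D [d Dd] [C1 oC1 DC1] [C2 cC2 DC2].
  have cQ : compact Q by exact: (subclosed_compact _ cB).
  have cD : compact D.
    apply: (subclosed_compact _ cQ); last by rewrite DC2; exact: subIsetl.
    by rewrite DC2; exact: closedI.
  have cE : compact (Q `\` D).
    apply: (subclosed_compact _ cQ); last by move=> y [].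
    rewrite (_ : Q `\` D = Q `&` ~` C1); first by apply: closedI => //; exact: open_closedC.
    rewrite DC1 eqEsubset; split=> y [Qy Dy]; split=> //.
      by move=> ?; apply: Dy.
    by move=> [].
  have [|U1 [U2 [oU1 oU2 DU1 EU2 U12]]] := compact_separation hG cD cE.
    by rewrite -subset0 => y [Dy [_]].
  have DQ : D `<=` Q by rewrite DC1; exact: subIsetl.
  have [V clV VU] : exists2 V, cl V & V `<=` U1 `|` U2.
    apply: small; first exact: openU.
    by move=> y Qy; have [Dy|Dy] := pselect (D y); [left; exact: DU1|right; exact: EU2].
  have clVU (O O' : set G) : open O -> open O' -> V `<=` O `|` O' ->
      O `&` O' = set0 -> O x -> cl (V `&` O).
    move=> oO oO' VOO OO Ox; case: clV => [Vx VB cV [P oP VP]]; split => //.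
    - by move=> y [Vy _]; exact: VB.
    - rewrite (_ : V `&` O = V `&` ~` O').
        by apply: closedI => //; exact: open_closedC.
      rewrite eqEsubset; split=> y [Vy Oy]; split=> //.
        by move=> O'y; suff : set0 y by []; rewrite -OO.
      by have [] := VOO _ Vy.
    - by exists (P `&` O); [exact: openI|rewrite VP setIA].
  have disj y : U1 y -> U2 y -> False.
    by move=> U1y U2y; suff : set0 y by []; rewrite -U12.
  have [Dx|Dx] := pselect (D x).
    have clU := clVU _ _ oU1 oU2 VU U12 (DU1 _ Dx).
    rewrite eqEsubset; split=> // y Qy.
    apply: contrapT => Dy.
    have [_ U1y] := Qy _ clU.
    by apply: (disj y) => //; exact: EU2.
  rewrite setUC in VU; rewrite setIC in U12.
  have clU := clVU _ _ oU2 oU1 VU U12 (EU2 _ (conj Qx Dx)).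
  have [_ U2d] := DQ _ Dd _ clU.
  by case: (disj d) => //; exact: DU1.
have QC : Q `<=` connected_component B x by exact: connected_component_max.
have [|V clV VW] := small W oW; first exact: subset_trans CW.
by case: clV => Vx VB cV [P oP VP]; exists V; split => //; exists P.
Qed.

(** A compact identity component is surrounded by a compact open set, and the
    stabiliser of that set under translation is an open subgroup inside it. *)
Lemma compact_open_subgroup : hausdorff_space G -> locally_compact [set: G] ->
  compact (identity_component G) ->
  exists K : set G, [/\ compact K, open K, K 0,
    forall x y, K x -> K y -> K (x + y) & forall x, K x -> K (- x)].
Proof.
move=> hG lcG cC; set C := identity_component G in cC *.
have C0 : C 0 by exact: connected_component_refl.
have [B cB CB] : exists2 B, compact B & C `<=` B°.
  pose F : set_system (set G) :=
    filter_from compact (fun V => [set V' | compact V' /\ V `<=` V']).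
  have FF : Filter F.
    apply: filter_from_filter; first by exists set0; exact: compact0.
    move=> V V' cV cV'; exists (V `|` V'); first exact: compactU.
    by move=> U [cU VVU]; split; split=> // y Vy; apply: VVU; [left|right].
  have /compact_near_coveringP/(_ _ F (fun V y => V° y) FF)[|V cV VC] := cC.
    move=> y _; have [U] := lcG y I.
    rewrite withinET => nU [cU _].
    exists (U°, [set V' | compact V' /\ U `<=` V']) => /=.
      split; last by exists U.
      exact: nbhs_interior.
    by move=> [y' V'] /= [Uy' [_ UV']]; exact: interiorS Uy'.
  by exists V => //; apply: VC; split.
have CsB : C `<=` B by apply: subset_trans CB _; exact: interior_subset.
have [V [V0 VB cV VBo [P oP VP]]] : exists V, [/\ V 0, V `<=` B, closed V,
    V `<=` B° & exists2 O, open O & V = B `&` O].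
  apply: component_clopen_basis => //; first exact: CsB.
    exact: open_interior.
  apply: subset_trans CB.
  apply: connected_component_max => //.
  - exact: connected_component_refl (CsB _ C0).
  - exact: component_connected.
have coV : compact V by exact: (subclosed_compact _ cB).
have oV : open V.
  rewrite (_ : V = B° `&` P); first by apply: openI => //; exact: open_interior.
  rewrite VP eqEsubset; split=> y [By Oy]; split=> //; last exact: interior_subset.
  by apply: VBo; rewrite VP.
pose K := [set x | forall v, V v -> V (x + v) /\ V (- x + v)].
have K0 : K 0 by move=> v Vv; rewrite oppr0 !add0r.
have KD x y : K x -> K y -> K (x + y).
  move=> Kx Ky v Vv; rewrite opprD -!addrA.
  by split; [exact: (Kx _ (Ky _ Vv).1).1|exact: (Kx _ (Ky _ Vv).2).2].
have KN x : K x -> K (- x) by move=> Kx v Vv; rewrite opprK; have [] := Kx _ Vv.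
have KV : K `<=` V by move=> x /(_ 0 V0)[]; rewrite addr0.
have nK : nbhs 0 K.
  apply: (iffLR (compact_near_coveringP V) coV _ (nbhs (0 : G))
    (fun x v => V (x + v) /\ V (- x + v)) _).
  move=> v Vv.
  have cf : continuous (fun w : G * G => w.2 + w.1).
    move=> w; under eq_fun do rewrite addrC.
    exact: add_continuous.
  have cg : continuous (fun w : G * G => - w.2 + w.1).
    move=> w; under eq_fun do rewrite addrC.
    exact: sub_continuous.
  apply: (@filterI _ (nbhs (v, (0 : G)))).
  - apply: (cf (v, 0)); apply: open_nbhs_nbhs; split => //=.
    by rewrite add0r.
  - apply: (cg (v, 0)); apply: open_nbhs_nbhs; split => //=.
    by rewrite oppr0 add0r.
have oK : open K.
  rewrite openE => x Kx; rewrite /interior.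
  have cx : continuous (fun y : G => - x + y) by exact: translation_continuous.
  have : nbhs x ((fun y => - x + y) @^-1` K) by apply: cx; rewrite addNr.
  by apply: filterS => y /= /(KD _ _ Kx); rewrite addNKr.
have clK : closed K.
  rewrite (_ : K = \bigcap_(v in V) ((fun x => x + v) @^-1` V `&`
     (fun x => - x + v) @^-1` V)).
    apply: closed_bigI => v _.
    apply: closedI; apply: preimage_closed => // x _.
    - under eq_fun do rewrite addrC.
      exact: translation_continuous.
    - under eq_fun do rewrite addrC.
      exact: reflection_continuous.
  by rewrite eqEsubset; split.
exists K; split => //.
exact: (subclosed_compact clK coV).
Qed.
End TopologicalGroup.

(** * Borel sets and Haar measure *)

Lemma countable_basis_seq (T : topologicalType) : @second_countable T ->
  exists e : nat -> set T, (forall n, open (e n)) /\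
    forall x U, nbhs x U -> exists n, e n x /\ e n `<=` U.
Proof.
move=> [B cB [oB bB]].
have [e eB] : exists e : nat -> set T, B `<=` range e.
  have [e es] := elimT (@pcard_surjP _ _ B [set: nat]) cB.
  by exists e => V BV; have [n _ nV] := es V BV; exists n.
exists (fun n => if `[< B (e n) >] then e n else set0); split.
  by move=> n; case: asboolP => [Bn|_]; [exact: oB|exact: open0].
move=> x U /bB[V [BV Vx VU]]; have [n _ Vn] := eB _ BV; exists n.
by case: asboolP; rewrite Vn//; split => //; exact: nbhs_singleton.
Qed.

Section Borel.
Variables (R : realType) (G : topologicalZmodType).

Lemma open_borel (A : set G) : open A -> measurable (A : set (borel G)).
Proof. by move=> oA; exact: sub_sigma_algebra. Qed.

Lemma closed_borel (A : set G) : closed A -> measurable (A : set (borel G)).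
Proof.
move=> cA; rewrite -(setCK (A : set (borel G))); apply: measurableC.
by apply: open_borel; exact: closed_openC.
Qed.

Lemma compact_borel (A : set G) : hausdorff_space G -> compact A ->
  measurable (A : set (borel G)).
Proof. by move=> hG cA; apply: closed_borel; exact: compact_closed. Qed.

Lemma borel_measurability d (T : measurableType d) (f : T -> borel G) :
  (forall B : set G, open B -> measurable (f @^-1` B)) -> measurable_fun setT f.
Proof.
move=> fB; apply: (@measurability _ _ T (borel G) setT f (@open G) erefl).
by move=> _ [B oB <-]; rewrite setTI; exact: fB.
Qed.

Lemma lsc_borel (f : G -> \bar R) : (forall a : R, open [set x | (a%:E < f x)%E]) ->
  measurable_fun setT (f : borel G -> \bar R).
Proof.
move=> oF; apply: (measurability _ (ErealGenOInfty.measurableE R)) => _ [_ [a ->] <-].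
rewrite setTI; apply: open_borel.
have := oF a; congr (open _); rewrite eqEsubset; split => x /=;
  by rewrite in_itv/= andbT.
Qed.

Lemma continuous_borel (f : G -> R) : continuous f ->
  measurable_fun setT (f : borel G -> R).
Proof.
move=> cf; apply/measurable_EFinP; apply: lsc_borel => a.
rewrite (_ : mkset _ = f @^-1` [set y | a < y]); last first.
  by apply/seteqP; split=> x /=; rewrite lte_fin.
by apply: open_comp; [move=> x _; exact: cf|exact: open_gt].
Qed.

Lemma translation_borel (x : G) : measurable_fun setT (fun y : borel G => (x + y : borel G)).
Proof.
apply: borel_measurability => B oB; apply: open_borel.
exact: (open_comp (fun y _ => @translation_continuous G x y) oB).
Qed.

(** Second countability makes the Borel sets of [G * G] the products of Borel
    sets; this is where the group law becomes measurable. *)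
Lemma open_prod_borel (W : set (G * G)) : @second_countable G -> open W ->
  measurable (W : set (borel G * borel G)).
Proof.
move=> /countable_basis_seq[e [oe be]] oW.
pose P (i j : nat) := e i `*` e j `<=` W.
have -> : W = \bigcup_i \bigcup_(j in P i) (e i `*` e j).
  rewrite eqEsubset; split=> [[x y] Wxy|z [i _ [j]]]; last exact.
  have [[/= U V] [nU nV] UVW] : nbhs (x, y) W by exact: open_nbhs_nbhs.
  have [i [xi iU]] := be _ _ nU; have [j [yj jV]] := be _ _ nV.
  exists i => //; exists j => //.
  by move=> [x' y'] [/= /iU ? /jV ?]; exact: UVW.
apply: bigcup_measurable => i _; apply: bigcup_measurable => j _.
by apply: (@measurableX _ _ (borel G) (borel G)); apply: open_borel.
Qed.

Lemma add_borel : @second_countable G ->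
  measurable_fun setT (fun z : borel G * borel G => ((z.1 : G) + z.2 : borel G)).
Proof.
move=> sG; apply: borel_measurability => B oB; apply: open_prod_borel => //.
apply: (@open_comp _ _ (fun z : G * G => z.1 + z.2)) => // z _.
exact: add_continuous.
Qed.

End Borel.

Section SigmaCompact.
Variable G : topologicalZmodType.
Hypotheses (hG : hausdorff_space G) (sG : @second_countable G)
  (lG : locally_compact [set: G]).

Lemma sigma_compact : exists C : nat -> set G,
  [/\ forall n, compact (C n), nondecreasing_seq C & \bigcup_n C n = setT].
Proof.
have [e [oe be]] := countable_basis_seq sG.
pose E n := if `[< precompact (e n) >] then closure (e n) else set0.
have cE n : compact (E n).
  rewrite /E; case: asboolP => [|_]; last exact: compact0.
  by rewrite precompactE.
exists (fun n => \big[setU/set0]_(i < n) E i); split.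
- by move=> n; exact: bigsetU_compact.
- move=> n k nk; apply/subsetPset; exact: subset_bigsetU.
- rewrite -subTset => x _.
  have [U] := lG (I : [set: G] x); rewrite withinET => nU [cU clU].
  have [n [nx VU]] := be _ _ nU.
  exists n.+1 => //; rewrite big_ord_recr /=; right.
  rewrite /E; case: asboolP => [_|]; first exact: subset_closure.
  by case; apply: (precompact_subset VU); rewrite precompact_closed.
Qed.

Lemma first_countable_at (x : G) : exists W : nat -> set G,
  (forall n, nbhs x (W n)) /\ forall U, nbhs x U -> \forall n \near \oo, W n `<=` U.
Proof.
have [e [oe be]] := countable_basis_seq sG.
pose E n := if `[< e n x >] then e n else setT.
have nE n : nbhs x (E n).
  rewrite /E; case: asboolP => [nx|_]; last exact: filterT.
  exact: open_nbhs_nbhs.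
exists (fun n => \big[setI/setT]_(i < n) E i); split.
  move=> n; elim/big_ind : _ => [|U V|i _]; [exact: filterT|exact: filterI|exact: nE].
move=> U /be[n [nx VU]].
near=> k; apply: subset_trans VU.
have nk : (n < k)%N by near: k; exact: nbhs_infty_gt.
rewrite (bigD1 (Ordinal nk)) //= => y [+ _].
by rewrite /E; case: asboolP.
Unshelve. all: by end_near. Qed.

End SigmaCompact.

Section HaarBasics.
Variables (R : realType) (G : topologicalZmodType).
Variable m : {measure set (borel G) -> \bar R}.
Hypothesis haar_m : haar_measure m.
Local Open Scope ereal_scope.

Lemma haar_translation (x : G) (A : set (borel G)) : measurable A ->
  m [set y | A (x + y)%R] = m A.
Proof.
move=> mA; have [_ _ _ _ /(_ (- x)%R A mA)] := haar_m.
by rewrite translation_image opprK.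
Qed.

Lemma ge0_integral_translation (x : G) (f : borel G -> \bar R) :
  measurable_fun setT f -> (forall y, 0 <= f y) ->
  \int[m]_y f (x + (y : G))%R = \int[m]_y f y.
Proof.
move=> mf f0; have mx := @translation_borel G x.
have := ge0_integral_pushforward mx m measurableT mf (fun y _ => f0 y).
rewrite preimage_setT => <-; apply: eq_measure_integral => A mA _.
exact: haar_translation.
Qed.

Lemma integral_translation (x : G) (f : borel G -> \bar R) : measurable_fun setT f ->
  \int[m]_y f (x + (y : G))%R = \int[m]_y f y.
Proof.
move=> mf; rewrite integralE [RHS]integralE; congr (_ - _).
  rewrite -(ge0_integral_translation x (measurable_funepos mf))//.
  by apply: eq_integral => y _; rewrite !funeposE.
rewrite -(ge0_integral_translation x (measurable_funeneg mf))//.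
by apply: eq_integral => y _; rewrite !funenegE.
Qed.

Lemma haar_compact (K : set G) : compact K -> m K < +oo.
Proof. by have [_ + _ _ _] := haar_m; exact. Qed.

Lemma haar_inner (U : set G) (a : \bar R) : open U -> a < m U ->
  exists K : set G, [/\ compact K, K `<=` U & a < m K].
Proof.
move=> oU; have [_ _ _ /(_ U oU) -> _] := haar_m.
by move=> /ereal_sup_gt[_ [K [cK KU] <-] aK]; exists K.
Qed.

Lemma haar_outer (A : set (borel G)) (a : \bar R) : measurable A -> m A < a ->
  exists U : set G, [/\ open U, A `<=` U & m U < a].
Proof.
move=> mA; have [_ _ /(_ A mA) -> _ _] := haar_m.
by move=> /ereal_inf_lt[_ [K [cK KU] <-] aK]; exists K.
Qed.

Hypotheses (hG : hausdorff_space G) (sG : @second_countable G)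
  (lG : locally_compact [set: G]).

Lemma haar_sigma_finite : sigma_finite setT m.
Proof.
have [C [cC ndC UC]] := sigma_compact sG lG.
exists C => //.
by move=> n; split; [exact: compact_borel|exact: haar_compact].
Qed.

Lemma integral_compact_tail (f : borel G -> \bar R) (e : R) :
  measurable_fun setT f -> (forall y, 0 <= f y) -> \int[m]_y f y < +oo ->
  (0 < e)%R -> exists2 C : set G, compact C & \int[m]_(y in ~` C) f y < e%:E.
Proof.
move=> mf f0 foo e0.
have [C [cC ndC UC]] := sigma_compact sG lG.
have mC n : measurable (C n : set (borel G)) by exact: compact_borel.
pose I := \int[m]_y f y.
have fin : I \is a fin_num by rewrite ge0_fin_numE// integral_ge0.
have cvI := @ge0_nondecreasing_set_cvg_integral _ (borel G) R C f m ndC mC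
  (fun i => measurable_funTS mf) (fun i x _ => f0 x).
rewrite UC in cvI.
have lI : I - e%:E < I by rewrite lteBlDr// lteDl.
have [n In] : exists n, I - e%:E < \int[m]_(y in C n) f y.
  exact: (@filter_ex _ \oo _ _ (cvI _ (open_ereal_gt' lI))).
exists (C n) => //.
have IE : I = \int[m]_(y in C n) f y + \int[m]_(y in ~` C n) f y.
  rewrite /I -(setUv (C n : set (borel G))) ge0_integral_setU//.
  - exact: measurableC.
  - exact: measurable_funTS.
  - by rewrite disj_set2E setICr.
have Cf : \int[m]_(y in C n) f y \is a fin_num.
  rewrite ge0_fin_numE ?integral_ge0//; apply: le_lt_trans foo.
  exact: ge0_subset_integral.
have Cf' : \int[m]_(y in ~` C n) f y \is a fin_num.
  rewrite ge0_fin_numE ?integral_ge0//; apply: le_lt_trans foo.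
  by apply: ge0_subset_integral => //; exact: measurableC.
move: In fin; rewrite IE -(fineK Cf) -(fineK Cf') => + _.
rewrite -EFinN -!EFinD !lte_fin.
by lra.
Qed.

End HaarBasics.

Lemma cvge_from_below (R : realType) (u : nat -> \bar R) (l : \bar R) :
  (forall n, (u n <= l)%E) -> (forall a, (a < l)%E -> \forall n \near \oo, (a < u n)%E) ->
  u @ \oo --> l.
Proof.
move=> ul al; case: l => [r||] in ul al *.
- have /al ru : ((r - 1)%:E < r%:E)%E by rewrite lte_fin; lra.
  apply/fine_cvgP; split.
    near=> n; have run : ((r - 1)%:E < u n)%E by near: n.
    by rewrite fin_numElt (lt_trans _ run) ?ltNyr//= (le_lt_trans (ul n)) ?ltry.
  apply/cvgrPdist_lt => e e0; near=> n => /=.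
  have ren : ((r - e)%:E < u n)%E by near: n; apply: al; rewrite lte_fin; lra.
  have := ul n; case: (u n) ren => [s||//]; last by rewrite leye_eq.
  rewrite lte_fin lee_fin /= => *; rewrite ger0_norm; lra.
- by apply/cvgeyPgt => a; apply: al; rewrite ltry.
- rewrite (_ : u = cst -oo%E); first exact: cvg_cst.
  by apply/funext => n; apply/eqP; rewrite -leeNy_eq.
Unshelve. all: by end_near. Qed.

(** * Overlaps of translates in the time-frequency plane *)

Lemma measureU_modular d (T : measurableType d) (R : realType)
    (m : {measure set T -> \bar R}) (A B : set T) : measurable A -> measurable B ->
  (m (A `|` B) + m (B `&` A) <= m A + m B)%E.
Proof.
move=> mA mB; rewrite (measureDI m mB mA) addeA leeD2r//.
have -> : A `|` B = A `|` (B `\` A) by rewrite setDE setUIr setUv setIT.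
by apply: measureU2 => //; exact: measurableD.
Qed.

(** [Y `&` A] is covered by [Y `\` X] and [X `&` A]; stated so as to avoid the
    subtraction of infinities. *)
Lemma measureI_triangle d (T : measurableType d) (R : realType)
    (m : {measure set T -> \bar R}) (X Y A : set T) :
  measurable X -> measurable Y -> measurable A ->
  (m (Y `&` A) + m (Y `&` X) <= m (X `&` A) + m Y)%E.
Proof.
move=> mX mY mA.
have mYX : measurable (Y `&` X) by exact: measurableI.
rewrite (measureDI m mYX mA) (measureDI m mY mA) addeC -addeA [leRHS]addeC -addeA.
apply: leeD.
  by apply: le_measure; rewrite ?inE; [exact: measurableD|exact: measurableD|exact: setSD].
rewrite [leRHS]addeC leeD2r// ; apply: le_measure; rewrite ?inE;
  [exact: measurableI|exact: measurableI|].
by move=> y [[]].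
Qed.

Section ProductSections.
Variables (R : realType) (G H : topologicalZmodType).
Implicit Types (A B S : set (G * H)) (x t : G).
Local Open Scope ereal_scope.

Lemma open_section A x : open A -> open (xsection A x).
Proof.
move=> oA; rewrite openE => y /xsectionP Axy; rewrite /interior.
have [[/= U V] [nU nV] UVA] : nbhs (x, y) A by exact: open_nbhs_nbhs.
apply: filterS nV => y' Vy'; apply/xsectionP; apply: UVA; split => //=.
exact: nbhs_singleton.
Qed.

Lemma section_tube A x (K : set H) : open A -> compact K -> K `<=` xsection A x ->
  \forall x' \near x, K `<=` xsection A x'.
Proof.
move=> oA cK KA.
apply: (iffLR (compact_near_coveringP K) cK _ (nbhs x)
  (fun x' y => xsection A x' y) _) => y Ky.
have /xsectionP Axy := KA _ Ky.
have [[/= U V] [nU nV] UVA] : nbhs (x, y) A by exact: open_nbhs_nbhs.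
by exists (V, U) => // -[y' x'] [/= Vy' Ux']; apply/xsectionP; exact: UVA.
Qed.

Definition time_shift t A : set (G * H) := [set z | A ((- t + z.1)%R, z.2)].

Lemma open_time_shift t A : open A -> open (time_shift t A).
Proof.
move=> oA; apply: (@open_comp _ _ (fun z : G * H => ((- t + z.1)%R, z.2))) => // z _.
apply: cvg_pair; last exact: cvg_snd.
apply: (@continuous_comp _ _ _ fst (fun y => - t + y)%R); first exact: cvg_fst.
exact: translation_continuous.
Qed.

Lemma xsection_time_shift t A x : xsection (time_shift t A) x = xsection A (- t + x)%R.
Proof. by apply/seteqP; split=> y /xsectionP ?; apply/xsectionP. Qed.

Lemma time_shift0 A : time_shift 0%R A = A.
Proof. by apply/seteqP; split=> -[x y]; rewrite /time_shift/= oppr0 add0r. Qed.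

Lemma time_shift_tube A x (K : set H) : open A -> compact K -> K `<=` xsection A x ->
  \forall t \near (0%R : G), K `<=` xsection (time_shift t A) x.
Proof.
move=> oA cK KA.
have cx : continuous (fun t : G => - t + x)%R.
  by under eq_fun do rewrite addrC; exact: reflection_continuous.
have : \forall t \near (0%R : G), K `<=` xsection A (- t + x)%R.
  have := cx 0%R; rewrite /continuous_at oppr0 add0r => cx0.
  exact: (cx0 _ (section_tube oA cK KA)).
apply: (@filterS _ _ _ (fun t => K `<=` xsection A (- t + x)%R)) => t.
by rewrite xsection_time_shift.
Qed.

Variables (m : {measure set (borel G) -> \bar R})
  (mu : {measure set (borel H) -> \bar R}).
Hypotheses (haar_m : haar_measure m) (haar_mu : haar_measure mu).
Hypotheses (hG : hausdorff_space G) (hH : hausdorff_space H).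

Lemma open_measure_le (U V : set H) : open U -> open V -> U `<=` V -> mu U <= mu V.
Proof.
by move=> oU oV UV; apply: le_measure => //; rewrite inE; exact: open_borel.
Qed.

Lemma compact_measure_le (K V : set H) : compact K -> open V -> K `<=` V -> mu K <= mu V.
Proof.
move=> cK oV KV; apply: le_measure => //; rewrite inE.
  exact: compact_borel.
exact: open_borel.
Qed.

(** A compact subset of the section at [x] that carries most of its measure is, by
    the tube lemma, contained in the sections at nearby points. *)
Lemma section_lsc A (a : R) : open A -> open [set x | a%:E < mu (xsection A x)].
Proof.
move=> oA; rewrite openE => x /= ax; rewrite /interior.
have [K [cK KA aK]] := haar_inner haar_mu (open_section x oA) ax.
apply: filterS (section_tube oA cK KA) => x' KA' /=.
apply: (lt_le_trans aK).
by apply: compact_measure_le => //; exact: open_section.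
Qed.

Lemma section_measurable A : open A ->
  measurable_fun setT (fun x : borel G => mu (xsection A (x : G))).
Proof. by move=> oA; apply: lsc_borel => a; exact: section_lsc. Qed.

Local Notation J A := ((m \x mu) (A : set (borel G * borel H))).

Lemma product_ge0 A : 0 <= J A.
Proof. by apply: integral_ge0 => x _; exact: measure_ge0. Qed.

Lemma product_le A B : open A -> open B -> A `<=` B -> J A <= J B.
Proof.
move=> oA oB AB; apply: ge0_le_integral => //.
- exact: section_measurable.
- exact: section_measurable.
- move=> x _; apply: open_measure_le; [exact: open_section|exact: open_section|].
  by move=> y /xsectionP Axy; apply/xsectionP; exact: AB.
Qed.

Lemma product_le2 A B C D : open A -> open B -> open C -> open D ->
  (forall x, mu (xsection A x) + mu (xsection B x) <=
             mu (xsection C x) + mu (xsection D x)) ->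
  J A + J B <= J C + J D.
Proof.
move=> oA oB oC oD h; rewrite /product_measure1 /=.
rewrite -!ge0_integralD//; try exact: section_measurable.
apply: ge0_le_integral => //.
- by move=> x _; exact: adde_ge0.
- by apply: emeasurable_funD; exact: section_measurable.
- by apply: emeasurable_funD; exact: section_measurable.
Qed.

Lemma product_time_shift t A : open A -> J (time_shift t A) = J A.
Proof.
move=> oA; rewrite /product_measure1.
rewrite -[RHS](ge0_integral_translation haar_m (- t)%R)//; last first.
  exact: section_measurable.

Qed.

Hypotheses (sG : @second_countable G) (lG : locally_compact [set: G]).

(** Inner regularity of [mu] makes the measure of the sections of an open set
    lower semicontinuous under translation; dominated convergence does the
    rest, along sequences since [G] is first countable. *)
Lemma overlap_near0 S (a : \bar R) : open S -> J S < +oo -> a < J S ->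
  \forall t \near (0%R : G), a < J (time_shift t S `&` S).
Proof.
move=> oS JS aS; apply: contrapT => nW.
have [W [nWn WU]] := first_countable_at sG (0%R : G).
have /choice[t tP] : forall n, exists t, W n t /\ ~ (a < J (time_shift t S `&` S)).
  move=> n; apply: contrapT => /forallNP nt; apply: nW; apply: filterS (nWn n) => t Wt.
  by apply: contrapT => at_; exact: (nt t).
have oSt n : open (time_shift (t n) S `&` S) by apply: openI => //; exact: open_time_shift.
have le_sec n x : mu (xsection (time_shift (t n) S `&` S) x) <= mu (xsection S x).
  apply: open_measure_le; [exact: open_section|exact: open_section|].
  by move=> y /xsectionP[_ Sy]; apply/xsectionP.
pose f n (x : borel G) := mu (xsection (time_shift (t n) S `&` S) (x : G)).
have mf n : measurable_fun setT (f n) by exact: section_measurable.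
pose g (x : borel G) := mu (xsection S (x : G)).
have mg : measurable_fun setT g by exact: section_measurable.
have ig : m.-integrable setT g.
  apply/integrableP; split => //.
  by under eq_integral do rewrite gee0_abs//.
have cvf (x : borel G) : f ^~ x @ \oo --> g x.
  apply: cvge_from_below => [n|b bx]; first exact: le_sec.
  have [K [cK KS bK]] := haar_inner haar_mu (open_section x oS) bx.
  have := WU _ (time_shift_tube oS cK KS); apply: filterS => n Wn.
  apply: (lt_le_trans bK); apply: compact_measure_le => //.
    by apply: open_section.
  move=> y Ky; have /xsectionP Sty := Wn _ (tP n).1 y Ky.
  by have /xsectionP Sy := KS _ Ky; apply/xsectionP.
have fg : {ae m, forall x n, setT x -> `|f n x| <= g x}.
  by apply: aeW => x n _; rewrite gee0_abs//; exact: le_sec.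
have cvf' : {ae m, forall x, setT x -> f ^~ x @ \oo --> g x}.
  by apply: aeW => x _; exact: cvf.
have [_ _ cJ] := dominated_convergence measurableT mf mg cvf' ig fg.
have [n /= an] : exists n, a < \int[m]_x f n x.
  exact: (@filter_ex _ \oo _ _ (cJ _ (open_ereal_gt' aS))).
by case: (tP n).
Qed.

(** Up to a small mass [A] lives over a compact set [C], and for [t] outside
    [C - C] the translate of [C] by [t] misses [C]; a noncompact closed set of
    translations is not contained in the compact set [C - C]. *)
Lemma overlap_vanishes S A (D : set G) : open S -> open A -> S `<=` A -> J A < +oo ->
  0 < J S -> closed D -> ~ compact D ->
  exists2 t, D t & J (time_shift t S `&` A) < J S.
Proof.
move=> oS oA SA JA JS0 cD ncD.
have JS : J S < +oo by apply: le_lt_trans JA; exact: product_le.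
have JSf : J S \is a fin_num by rewrite ge0_fin_numE// product_ge0.
pose w (x : borel G) := mu (xsection A (x : G)).
have mw : measurable_fun setT w by exact: section_measurable.
have w0 x : 0 <= w x by exact: measure_ge0.
have e0 : (0 < fine (J S) / 2)%R by rewrite divr_gt0// fine_gt0// JS0.
have [C cC wC] := integral_compact_tail hG sG lG mw w0 JA e0.
have [t Dt nt] : exists2 t, D t & forall a b, C a -> C b -> t <> (a - b)%R.
  apply: contrapT => /forall2NP nt; apply: ncD.
  apply: (subclosed_compact cD (compactB cC cC)) => t Dt.
  have [//|/existsNP[a /existsNP[b /not_implyP[Ca /not_implyP[Cb /contrapT ->]]]]] := nt t.
  by exists a => //; exists b.
exists t => //.
have mC : measurable (~` C : set (borel G)).
  by apply: measurableC; exact: compact_borel.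
pose h := w \_ (~` C : set (borel G)).
have mh : measurable_fun setT h.
  by apply: (iffLR (measurable_restrictT w mC)); exact: measurable_funTS.
have h0 x : 0 <= h x by rewrite /h patchE; case: ifP.
have oSt : open (time_shift t S `&` A) by apply: openI => //; exact: open_time_shift.
have mht : measurable_fun setT (fun x : borel G => h (- t + (x : G))%R).
  exact: (measurableT_comp mh (@translation_borel G (- t)%R)).
apply: (@le_lt_trans _ _ (\int[m]_x (h x + h (- t + (x : G))%R))).
  apply: ge0_le_integral => //.
  - exact: section_measurable.
  - exact: emeasurable_funD.
  move=> x _; have [Cx|Cx] := pselect (C x); last first.
    rewrite [in leRHS]/h patchE mem_set// -[leLHS]adde0; apply: leeD => //.
    apply: open_measure_le; [exact: open_section|exact: open_section|].
    by move=> y /xsectionP[_ Ay]; apply/xsectionP.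
  rewrite -[leLHS]add0e; apply: leeD => //.
  rewrite /h patchE mem_set; last first.
    by move=> Ctx; apply: (nt _ _ Cx Ctx); rewrite opprD opprK addrCA subrr addr0.
  apply: open_measure_le; [exact: open_section|exact: open_section|].
  by move=> y /xsectionP[+ _]; rewrite /time_shift/= => ?; apply/xsectionP; exact: SA.
rewrite ge0_integralD// ge0_integral_translation//.
rewrite /h -integral_mkcond -(fineK JSf).
apply: lt_le_trans (lteD wC wC) _.
by rewrite -EFinD lee_fin -splitr.
Qed.

(** Along a connected set the overlap of [S] with its translates varies
    continuously, so it cannot jump from a total overlap at [0] to a partial
    one far away. *)
Lemma small_positive_escape S A (D : set G) (d : R) :
  open S -> open A -> S `<=` A -> J A < +oo -> 0 < J S -> closed D -> ~ compact D -> connected D -> D 0%R -> (0 < d)%R ->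
  exists t, J S - d%:E < J (time_shift t S `&` A) < J S.
Proof.
move=> oS oA SA JA JS0 cD ncD conD D0 d0.
have JS : J S < +oo by apply: le_lt_trans JA; exact: product_le.
have JSf : J S \is a fin_num by rewrite ge0_fin_numE// product_ge0.
have oSt t : open (time_shift t S) by exact: open_time_shift.
pose phi t := J (time_shift t S `&` A).
have oStA t : open (time_shift t S `&` A) by exact: openI.
have phi_le t : phi t <= J S.
  by rewrite -(product_time_shift t oS); apply: product_le => // z [].
have phif t : phi t \is a fin_num.
  by rewrite ge0_fin_numE ?product_ge0// (le_lt_trans (phi_le t)).
have phi_near t t' : phi t' + J (time_shift (t' - t)%R S `&` S) <= phi t + J S.
  have oK : open (time_shift (t' - t)%R S `&` S) by exact: openI.
  rewrite -(product_time_shift t oK) -(product_time_shift t' oS).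
  apply: product_le2 => // [|x]; first exact: open_time_shift.
  have mS z : measurable (xsection S z : set (borel H)).
    by apply: open_borel; exact: open_section.
  have mA : measurable (xsection A x : set (borel H)).
    by apply: open_borel; exact: open_section.
  have := measureI_triangle mu (mS (- t + x)%R) (mS (- t' + x)%R) mA.
  rewrite !xsection_time_shift !xsectionI !xsection_time_shift.
  by rewrite opprB addrACA subrr add0r.
have lt_d : J S - d%:E < J S by rewrite lteBlDr// lteDl.
(* the overlap of two translates depends only on the difference of the
   translations, so continuity at [0] is uniform *)
have kappa := overlap_near0 oS JS lt_d.
have phi0 : phi 0%R = J S by rewrite /phi time_shift0 setIidl.
apply: contrapT => /forallNP no.
have gap t : phi t < J S -> phi t <= J S - d%:E.
  move=> tS; rewrite leNgt; apply/negP => dt.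
  by apply: (no t); rewrite dt.
have near_sub (t : G) : \forall t' \near t, J S - d%:E < J (time_shift (t' - t)%R S `&` S).
  have := @translation_continuous G (- t)%R t; rewrite /continuous_at addNr => ct.
  by near=> t'; rewrite (addrC t'); near: t'; exact: (ct _ kappa).
have near_sub' (t : G) : \forall t' \near t, J S - d%:E < J (time_shift (t - t')%R S `&` S).
  have := @reflection_continuous G t t; rewrite /continuous_at subrr => ct.
  exact: (ct _ kappa).
pose E := [set t | D t /\ phi t = J S].
have ED : E = D.
  (* total overlap is a clopen condition on [D] if there are no almost total ones *)
  apply: conD.
  - by exists 0%R.
  - exists [set t | J S - d%:E < phi t]°; first exact: open_interior.
    apply/seteqP; split=> t [Dt pt]; split=> //.
      rewrite /interior; apply: filterS (near_sub' t) => t' /= kt.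
      have := phi_near t' t; rewrite pt [leRHS]addeC.
      rewrite leeD2lE// => h; exact: lt_le_trans h.
    move: pt => /interior_subset /= pt; apply/eqP; rewrite eq_le phi_le /=.
    by rewrite leNgt; apply/negP => /gap; rewrite leNgt pt.
  - exists (~` [set t | phi t < J S]°).
      by apply: open_closedC; exact: open_interior.
    apply/seteqP; split=> t [Dt pt]; split=> //.
      by move=> /interior_subset /=; rewrite pt ltxx.
    apply/eqP; rewrite eq_le phi_le /= leNgt; apply/negP => tS; apply: pt.
    rewrite /= /interior; apply: filterS (near_sub t) => t' /= kt.
    have oK : open (time_shift (t' - t)%R S `&` S) by exact: openI.
    have kf : J (time_shift (t' - t)%R S `&` S) \is a fin_num.
      rewrite ge0_fin_numE ?product_ge0// (le_lt_trans _ JS)//.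
      by apply: product_le => // z [].
    move: (phi_near t t') kt (gap _ tS).
    rewrite -(fineK kf) -(fineK JSf) -(fineK (phif t)) -(fineK (phif t')).
    rewrite -EFinN -!EFinD !lte_fin !lee_fin; lra.
have [t Dt] := overlap_vanishes oS oA SA JA JS0 cD ncD.
by rewrite -ED in Dt; case: Dt => _ pt; rewrite -[X in X < _]/(phi t) pt ltxx.
Unshelve. all: by end_near. Qed.

End ProductSections.

(** * Continuity of translations *)

Section TranslationL1.
Variables (R : realType) (G : topologicalZmodType).
Variable m : {measure set (borel G) -> \bar R}.
Hypothesis haar_m : haar_measure m.
Hypothesis hG : hausdorff_space G.
Implicit Types (u v w : borel G -> R) (t : G).
Import HBSimple.
Local Open Scope ereal_scope.

Lemma measurable_normE v : measurable_fun setT v ->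
  measurable_fun setT (fun y => `|v y|%:E).
Proof. by move=> mv; apply/measurable_EFinP; exact: measurableT_comp. Qed.

Lemma measurable_translate v t : measurable_fun setT v ->
  measurable_fun setT (fun y : borel G => v (- t + (y : G))%R).
Proof. by move=> mv; exact: (measurableT_comp mv (@translation_borel G (- t)%R)). Qed.

Lemma norm1_triangle u v : measurable_fun setT u -> measurable_fun setT v ->
  \int[m]_y `|u y + v y|%:E <= \int[m]_y `|u y|%:E + \int[m]_y `|v y|%:E.
Proof.
move=> mu mv; rewrite -ge0_integralD//; try exact: measurable_normE.
apply: ge0_le_integral => //.
- by apply: measurable_normE; exact: measurable_funD.
- by apply: emeasurable_funD; exact: measurable_normE.
- by move=> y _; rewrite -EFinD lee_fin ler_normD.
Qed.

Definition translation_continuousL1 v := forall e : R, (0 < e)%R ->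
  \forall t \near (0%R : G), \int[m]_y `|v (- t + (y : G))%R - v y|%:E < e%:E.

Local Notation tcont := translation_continuousL1.

Lemma tcont_approx v : measurable_fun setT v ->
  (forall e : R, (0 < e)%R -> exists w,
    [/\ measurable_fun setT w, tcont w & \int[m]_y `|v y - w y|%:E < e%:E]) ->
  tcont v.
Proof.
move=> mv appr e e0; have [|w [mw cw vw]] := appr (e / 3)%R; first by lra.
have e3 : (0 < e / 3)%R by lra.
have := cw _ e3; apply: filterS => t wt.
have mvt := measurable_translate t mv; have mwt := measurable_translate t mw.
pose d y := (v y - w y)%R.
have md : measurable_fun setT d by exact: measurable_funB.
have mdt : measurable_fun setT (fun y : borel G => d (- t + (y : G))%R).
  exact: measurable_translate.
have E y : (v (- t + (y : G)) - v y = (d (- t + (y : G)) +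
    (w (- t + (y : G)) - w y)) + - d y)%R by rewrite /d; ring.
under eq_integral do rewrite E.
have h1 := norm1_triangle (measurable_funD mdt (measurable_funB mwt mw))
  (measurable_funN md).
have h2 := norm1_triangle mdt (measurable_funB mwt mw).
apply: (le_lt_trans h1); under [X in _ + X]eq_integral do rewrite normrN.
have -> : e%:E = ((e / 3)%:E + (e / 3)%:E) + (e / 3)%:E.
  by rewrite -!EFinD; congr EFin; lra.
apply: lteD => //; apply: (le_lt_trans h2); apply: lteD => //.
rewrite (ge0_integral_translation haar_m (- t)%R (f := fun y => `|d y|%:E))//.
exact: measurable_normE.
Qed.

Lemma tcontD u v : measurable_fun setT u -> measurable_fun setT v ->
  tcont u -> tcont v -> tcont (fun y => u y + v y)%R.
Proof.
move=> mu mv cu cv e e0; have e2 : (0 < e / 2)%R by lra.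
near=> t.
have E (y : borel G) : (u (- t + (y : G)) + v (- t + (y : G)) - (u y + v y) =
  (u (- t + (y : G)) - u y) + (v (- t + (y : G)) - v y))%R by ring.
under eq_integral do rewrite E.
have mut := measurable_funB (measurable_translate t mu) mu.
have mvt := measurable_funB (measurable_translate t mv) mv.
apply: (le_lt_trans (norm1_triangle mut mvt)).
rewrite [e]splitr EFinD; apply: lteD.
  by near: t; exact: cu.
by near: t; exact: cv.
Unshelve. all: by end_near. Qed.

Lemma tcontZ (k : R) v : measurable_fun setT v -> tcont v -> tcont (fun y => k * v y)%R.
Proof.
move=> mv cv e e0.
have k0 : (0 < `|k| + 1)%R by rewrite ltr_wpDl.
have ek : (0 < e / (`|k| + 1))%R by rewrite divr_gt0.
have := cv _ ek; apply: filterS => t vt.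
have mvt := measurable_funB (measurable_translate t mv) mv.
under eq_integral do rewrite -mulrBr normrM EFinM.
rewrite ge0_integralZl_EFin//; last exact: measurable_normE.
apply: (@le_lt_trans _ _ ((`|k| + 1)%:E * \int[m]_y `|v (- t + (y : G))%R - v y|%:E)).
  by apply: lee_wpmul2r; [exact: integral_ge0|rewrite lee_fin lerDl].
have -> : e%:E = (`|k| + 1)%:E * (e / (`|k| + 1))%:E.
  by rewrite -EFinM; congr EFin; field; rewrite gt_eqF.
by rewrite lte_pmul2l// lte_fin.
Qed.

Lemma indic_translate (A : set (borel G)) t (y : borel G) :
  (\1_A (- t + (y : G)) = \1_[set y : borel G | A (- t + (y : G))] y :> R)%R.
Proof. by rewrite !indicE; congr ((_ : bool)%:R)%R; apply/idP/idP; rewrite !inE. Qed.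

Lemma translate_borel (A : set (borel G)) t : measurable A ->
  measurable [set y : borel G | A (- t + (y : G))%R].
Proof.
move=> mA; rewrite -[X in measurable X]setTI.
exact: (@translation_borel G (- t)%R measurableT A mA).
Qed.

(** Inner regularity: most of the mass of [O] sits on a compact set, whose
    small translates stay in [O]. *)
Lemma open_overlap (O : set G) (a : \bar R) : open O -> a < m O ->
  \forall t \near (0%R : G), a < m (O `&` [set y | O (- t + y)%R]).
Proof.
move=> oO aO; have [K [cK KO aK]] := haar_inner haar_m oO aO.
have : \forall t \near (0%R : G), K `<=` [set y | O (- t + y)%R].
  apply: (iffLR (compact_near_coveringP K) cK _ (nbhs (0%R : G))
    (fun t y => O (- t + y)%R) _) => y Ky.
  have cs : continuous (fun z : G * G => - z.2 + z.1)%R.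
    by move=> z; under eq_fun do rewrite addrC; exact: sub_continuous.
  apply: (cs (y, 0%R)); apply: open_nbhs_nbhs; split => //=.
  by rewrite oppr0 add0r; exact: KO.
apply: filterS => t Kt; apply: (lt_le_trans aK).
apply: le_measure; rewrite ?inE.
- exact: compact_borel.
- apply: measurableI; first exact: open_borel.
  by apply: translate_borel; exact: open_borel.
- by move=> y Ky; split; [exact: KO|exact: Kt].
Qed.

Lemma tcont_open (O : set G) : open O -> m O < +oo -> tcont (\1_(O : set (borel G))).
Proof.
move=> oO Ooo e e0.
have mO : measurable (O : set (borel G)) by exact: open_borel.
have Of : m O \is a fin_num by rewrite ge0_fin_numE.
have : m O - (e / 2)%:E < m O by rewrite lteBlDr// lteDl// lte_fin; lra.
move=> /(open_overlap oO); apply: filterS => t Ot.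
set Q := [set y : borel G | O (- t + (y : G))%R] in Ot.
have mQ : measurable Q by exact: translate_borel.
have mOQ : measurable ((O : set (borel G)) `&` Q) by exact: measurableI.
have OQf : m ((O : set (borel G)) `&` Q) \is a fin_num.
  rewrite ge0_fin_numE//; apply: le_lt_trans Ooo.
  by apply: le_measure; rewrite ?inE//; exact: subIsetl.
under eq_integral do rewrite indic_translate.
rewrite -/Q.
have mi (B : set (borel G)) : measurable B ->
    measurable_fun setT (fun y => (\1_B y : R)%:E).
  by move=> mB; apply/measurable_EFinP; exact: measurable_indic.
have mN : measurable_fun setT (fun y => `|\1_Q y - \1_(O : set (borel G)) y|%:E : \bar R).
  by apply: measurable_normE; apply: measurable_funB; exact: measurable_indic.
have I0 B : forall y : borel G, setT y -> 0 <= (\1_B y : R)%:E.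
  by move=> y _; rewrite lee_fin.
have : \int[m]_y (`|\1_Q y - \1_(O : set (borel G)) y|%:E +
    ((\1_(O `&` Q : set (borel G)) y : R)%:E + (\1_(O `&` Q : set (borel G)) y : R)%:E)) =
    \int[m]_y ((\1_Q y : R)%:E + (\1_(O : set (borel G)) y : R)%:E).
  apply: eq_integral => y _; rewrite -!EFinD; congr EFin; rewrite !indicE in_setI.
  case: (y \in O); case: (y \in Q) => /=;
    by rewrite ?(subrr, normr0, subr0, sub0r, normrN1, normr1); ring.
rewrite !ge0_integralD//; try exact: mi; last 2 first.
  by move=> y _; exact: adde_ge0.
  by apply: emeasurable_funD; exact: mi.
rewrite !integral_indic// !setIT.
have -> : m Q = m O by exact: haar_translation.
move: Ot; rewrite -(fineK Of) -(fineK OQf); set I := \int[m]_y _ => Ot.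
case: I => [r|//|//]; move: Ot.
by rewrite -EFinN -!EFinD !lte_fin => h [] ?; lra.
Qed.

Lemma tcont_borel (A : set (borel G)) : measurable A -> m A < +oo -> tcont (\1_A).
Proof.
move=> mA Aoo; apply: tcont_approx; first exact: measurable_indic.
move=> e e0; have Af : m A \is a fin_num by rewrite ge0_fin_numE.
have : m A < m A + e%:E by rewrite lteDl.
move=> /(haar_outer haar_m mA)[U [oU AU Ue]].
have mU : measurable (U : set (borel G)) by exact: open_borel.
exists (\1_(U : set (borel G))); split.
- exact: measurable_indic.
- by apply: tcont_open => //; rewrite (lt_trans Ue)// -(fineK Af) -EFinD ltry.
have -> : \int[m]_y `|\1_A y - \1_(U : set (borel G)) y|%:E =
    \int[m]_y (\1_(U `\` A : set (borel G)) y)%:E.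
  apply: eq_integral => y _; congr EFin; rewrite !indicE in_setD.
  have [Ay|Ay] := pselect (A y).
    by rewrite (mem_set Ay) (mem_set (AU _ Ay)) subrr normr0.
  by rewrite (memNset Ay) sub0r normrN ger0_norm//= andbT.
rewrite integral_indic ?setIT; [|exact: measurableT|exact: measurableD].
move: Ue; rewrite (measureDI m mU mA) (setIidr AU) addeC lteD2lE//.
Qed.

(** From open sets to Borel sets by outer regularity, then to simple functions by
    linearity, then to integrable functions by density. *)
Lemma tcont_integrable v : m.-integrable setT (EFin \o v) -> tcont v.
Proof.
move=> iv; have mv : measurable_fun setT v by apply/measurable_EFinP; exact: measurable_int iv.
apply: tcont_approx => // e e0.
have [g [ig _ cg]] := approximation_sfun_integrable measurableT iv.
have e0' : (0%:E < e%:E :> \bar R) by rewrite lte_fin.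
have [n ne] : exists n, \int[m]_y `|(EFin \o v) y - (g n y)%:E| < e%:E.
  exact: (@filter_ex _ \oo _ _ (cg _ (open_ereal_lt' e0'))).
exists (g n); split => //.
have {ne} := ig n; move: (g n) => {g ig cg n} f jf.
have mf (r : R) : measurable (f @^-1` [set r]) by exact: measurable_funPTI.
have fr (r : R) : r != 0%R -> m (f @^-1` [set r]) < +oo.
  move=> r0; have /integrableP[_] := jf.
  have : `|r|%:E * m (f @^-1` [set r]) <= \int[m]_y `|(EFin \o f) y|.
    rewrite -[X in m X]setIT -integral_indic// -ge0_integralZl_EFin//.
    - apply: ge0_le_integral => //.
      + apply/measurable_EFinP; apply: measurable_funM => //; exact: measurable_indic.
      + by apply: measurableT_comp => //; exact: measurable_int jf.
      + move=> y _; rewrite -EFinM lee_fin indicE.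
        have [fy|fy] := pselect ((f @^-1` [set r]) y).
          by rewrite (mem_set fy) mulr1 -fy.
        by rewrite (memNset fy) mulr0.
    - by apply/measurable_EFinP; exact: measurable_indic.
  move=> /le_lt_trans h /h roo; rewrite ltNge leye_eq.
  by apply/negP => /eqP foo; move: roo; rewrite foo gt0_muley ?lte_fin ?normr_gt0.
have fE : f = (fun y => \sum_(r <- finmap.enum_fset (fset_set (range f)))
    (r * \1_(f @^-1` [set r]) y))%R :> (_ -> _).
  apply/funext => y; rewrite [LHS]fimfunE fsbig_finite//.
rewrite fE.
pose P (h : borel G -> R) := measurable_fun setT h /\ tcont h.
suff : P (fun y => \sum_(r <- finmap.enum_fset (fset_set (range f)))
    (r * \1_(f @^-1` [set r]) y))%R by case.
elim: (finmap.enum_fset _) => [|r s [ms cs]].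
  under eq_fun do rewrite big_nil.
  split; first exact: measurable_cst.
  move=> d d0; near=> t.
  by under eq_integral do rewrite subrr normr0; rewrite integral0 lte_fin.
under eq_fun do rewrite big_cons.
have mr : measurable_fun setT (fun y => r * \1_(f @^-1` [set r]) y : R)%R.
  by apply: measurable_funM => //; exact: measurable_indic.
split; first exact: measurable_funD.
apply: tcontD => //; have [->|r0] := eqVneq r 0%R.
  under eq_fun do rewrite mul0r.
  move=> d d0; near=> t.
  by under eq_integral do rewrite subrr normr0; rewrite integral0 lte_fin.
apply: tcontZ; first exact: measurable_indic.
by apply: tcont_borel => //; exact: fr.
Unshelve. all: by end_near. Qed.

End TranslationL1.

(** Squared moduli take values in [R] rather than in [R[i]], as integrands do. *)
Notation csq z := (ComplexField.Normc.normc z ^+ 2).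

Section SquaredModulus.
Variable R : realType.
Implicit Types z w : R[i].

Lemma csqE z : csq z = complex.Re z ^+ 2 + complex.Im z ^+ 2.
Proof. by case: z => a b /=; rewrite sqr_sqrtr// addr_ge0// sqr_ge0. Qed.

Lemma csq_ge0 z : 0 <= csq z.
Proof. exact: sqr_ge0. Qed.

Lemma csqM z w : csq (z * w) = csq z * csq w.
Proof. by rewrite ComplexField.Normc.normcM exprMn. Qed.

Lemma csqD_le z w : csq (z + w) <= 2 * (csq z + csq w).
Proof.
rewrite !csqE; case: z w => [a b] [c d] /=.
by have := sqr_ge0 (a - c); have := sqr_ge0 (b - d); nra.
Qed.

Lemma csqN z : csq (- z) = csq z.
Proof. by rewrite !csqE; case: z => a b /=; rewrite !sqrrN. Qed.

Lemma complexReB z w : complex.Re (z - w) = complex.Re z - complex.Re w.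
Proof. by case: z w => [a b] [c d]. Qed.

Lemma complexImB z w : complex.Im (z - w) = complex.Im z - complex.Im w.
Proof. by case: z w => [a b] [c d]. Qed.

(** The inverse of the signed square is 1/2-Hoelder continuous, which reduces the
    continuity of translations in [L2] to their continuity in [L1]. *)
Lemma sqr_sub_le (a b : R) : (a - b) ^+ 2 <= 2 * `|a * `|a| - b * `|b| |.
Proof.
wlog ab : a b / b <= a.
  move=> H; have [/H//|/ltW/H] := leP b a.
  by rewrite -sqrrN opprB distrC.
apply: (@le_trans _ _ (2 * (a * `|a| - b * `|b|))); last first.
  by rewrite ler_pM2l// ler_norm.
have [a0|a0] := leP 0 a; have [b0|b0] := leP 0 b.
- rewrite !ger0_norm//; have := mulr_ge0 b0 (_ : 0 <= a - b); rewrite subr_ge0 => /(_ ab).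
  by have := mulr_ge0 a0 (_ : 0 <= a - b); rewrite subr_ge0 => /(_ ab); nra.
- by rewrite (ger0_norm a0) (ltr0_norm b0); have := sqr_ge0 (a + b); nra.
- lra.
- rewrite !ltr0_norm//; have ab' : 0 <= a - b by rewrite subr_ge0.
  have a0' : 0 <= - a by lra. have b0' : 0 <= - b by lra.
  have := mulr_ge0 a0' ab'; have := mulr_ge0 b0' ab'; nra.
Qed.

End SquaredModulus.

Section TranslationL2.
Variables (R : realType) (G : topologicalZmodType).
Variable m : {measure set (borel G) -> \bar R}.
Hypothesis haar_m : haar_measure m.
Hypothesis hG : hausdorff_space G.
Local Open Scope ereal_scope.

Lemma translation_continuousL2 (f : borel G -> R[i]) (e : R) : L2 m f -> (0 < e)%R ->
  \forall t \near (0%R : G), \int[m]_y (csq (f (- t + (y : G)) - f y))%:E < e%:E.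
Proof.
move=> [[mRe mIm] foo] e0; have e4 : (0 < e / 4)%R by lra.
pose s (u : borel G -> R) y := (u y * `|u y|)%R.
have ms u : measurable_fun setT u -> measurable_fun setT (s u).
  by move=> mu; apply: measurable_funM => //; exact: measurableT_comp.
have is_ (u : borel G -> R) : measurable_fun setT u -> (forall y, u y ^+ 2 <= csq (f y))%R ->
    m.-integrable setT (EFin \o s u).
  move=> mu uf; apply/integrableP; split; first by apply/measurable_EFinP; exact: ms.
  apply: le_lt_trans foo; apply: ge0_le_integral => //.
  - by apply: measurable_normE; exact: ms.
  - apply/measurable_EFinP; under eq_fun do rewrite csqE.
    by apply: measurable_funD; exact: measurable_funX.
  - move=> y _ /=; rewrite lee_fin; apply: le_trans (uf y).
    by rewrite /s normrM normr_id -normrM -expr2 ger0_norm// sqr_ge0.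
set a := fun y => complex.Re (f y) in mRe; set b := fun y => complex.Im (f y) in mIm.
have ia : m.-integrable setT (EFin \o s a).
  by apply: is_ => // y; rewrite csqE lerDl sqr_ge0.
have ib : m.-integrable setT (EFin \o s b).
  by apply: is_ => // y; rewrite csqE lerDr sqr_ge0.
have := @tcont_integrable _ _ _ haar_m hG _ ia _ e4.
have := @tcont_integrable _ _ _ haar_m hG _ ib _ e4.
move=> h1 h2.
near=> t.
have mst (u : borel G -> R) (mu : measurable_fun setT u) :=
  measurable_funB (measurable_translate t (ms u mu)) (ms u mu).
apply: (@le_lt_trans _ _ (\int[m]_y (2%:E * (`|s a (- t + (y : G)) - s a y|%:E +
    `|s b (- t + (y : G)) - s b y|%:E)))).
  apply: ge0_le_integral => //.
  - by move=> y _; rewrite lee_fin csq_ge0.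
  - apply/measurable_EFinP; under eq_fun do rewrite csqE complexReB complexImB.
    apply: measurable_funD; apply: measurable_funX; apply: measurable_funB => //.
      exact: (measurable_translate t mRe).
    exact: (measurable_translate t mIm).
  - apply: measurable_funeM; apply: emeasurable_funD; apply: measurable_normE; exact: mst.
  - move=> y _; rewrite -EFinD -EFinM lee_fin csqE complexReB complexImB mulrDr.
    by apply: lerD; exact: sqr_sub_le.
rewrite ge0_integralZl_EFin//; last 2 first.
  by move=> y _; exact: adde_ge0.
  by apply: emeasurable_funD; apply: measurable_normE; exact: mst.
rewrite ge0_integralD//; last 2 first.
  by apply: measurable_normE; exact: mst.
  by apply: measurable_normE; exact: mst.
have -> : e%:E = 2%:E * ((e / 4)%:E + (e / 4)%:E).
  by rewrite -EFinD -EFinM; congr EFin; lra.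
rewrite lte_pmul2l//; apply: lteD.
  by near: t; exact: h2.
by near: t; exact: h1.
Unshelve. all: by end_near. Qed.

End TranslationL2.

(** * The inner product of square integrable functions *)

Section ComplexParts.
Variable R : realType.
Implicit Types z w : R[i].

Lemma complexP z w : complex.Re z = complex.Re w -> complex.Im z = complex.Im w -> z = w.
Proof. by case: z w => [a b] [c d] /= -> ->. Qed.

Lemma complexReD z w : complex.Re (z + w) = complex.Re z + complex.Re w.
Proof. by case: z w => [a b] [c d]. Qed.

Lemma complexImD z w : complex.Im (z + w) = complex.Im z + complex.Im w.
Proof. by case: z w => [a b] [c d]. Qed.

Lemma complexReM z w :
  complex.Re (z * w) = complex.Re z * complex.Re w - complex.Im z * complex.Im w.
Proof. by case: z w => [a b] [c d]. Qed.

Lemma complexImM z w :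
  complex.Im (z * w) = complex.Re z * complex.Im w + complex.Im z * complex.Re w.
Proof. by case: z w => [a b] [c d]. Qed.

Lemma complexRe_conj z : complex.Re (conjc z) = complex.Re z.
Proof. by case: z. Qed.

Lemma complexIm_conj z : complex.Im (conjc z) = - complex.Im z.
Proof. by case: z. Qed.

Definition complex_partsE := (complexReD, complexImD, complexReM, complexImM,
  complexRe_conj, complexIm_conj).

Lemma csq_conj z : csq (conjc z) = csq z.
Proof. by rewrite !csqE !complex_partsE sqrrN. Qed.

Lemma csq_eq0 z : (csq z == 0) = (z == 0).
Proof.
rewrite csqE paddr_eq0 ?sqr_ge0// !sqrf_eq0; apply/andP/eqP => [[/eqP a /eqP b]|->//].
exact: complexP.
Qed.

End ComplexParts.

Section L2Algebra.
Context {d : measure_display} {T : measurableType d} {R : realType}.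
Variable m : {measure set T -> \bar R}.
Implicit Types (f g h e : T -> R[i]) (a : R[i]).

Local Notation dot := (L2dot m).

Definition sqnorm f : R := \int[m]_x csq (f x).

Lemma cmeasurableD f g : cmeasurable f -> cmeasurable g ->
  cmeasurable (fun x => f x + g x).
Proof.
move=> [fr fi] [gr gi]; split.
  by under eq_fun do rewrite complex_partsE; exact: measurable_funD.
by under eq_fun do rewrite complex_partsE; exact: measurable_funD.
Qed.

Lemma cmeasurableM f g : cmeasurable f -> cmeasurable g ->
  cmeasurable (fun x => f x * g x).
Proof.
move=> [fr fi] [gr gi]; split.
  by under eq_fun do rewrite complex_partsE; apply: measurable_funB; exact: measurable_funM.
by under eq_fun do rewrite complex_partsE; apply: measurable_funD; exact: measurable_funM.
Qed.

Lemma cmeasurable_cst a : cmeasurable (fun _ : T => a).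
Proof. by split; exact: measurable_cst. Qed.

Lemma cmeasurable_conj f : cmeasurable f -> cmeasurable (fun x => conjc (f x)).
Proof.
move=> [fr fi]; split.
  by under eq_fun do rewrite complex_partsE.
by under eq_fun do rewrite complex_partsE; exact: measurable_funN.
Qed.

Lemma measurable_csq f : cmeasurable f -> measurable_fun setT (fun x => csq (f x)).
Proof.
move=> [fr fi]; under eq_fun do rewrite csqE.
by apply: measurable_funD; exact: measurable_funX.
Qed.

Lemma L2_integrable f : L2 m f -> m.-integrable setT (fun x => (csq (f x))%:E).
Proof.
move=> [mf foo]; apply/integrableP; split; first exact/measurable_EFinP/measurable_csq.
by under eq_integral do rewrite gee0_abs ?lee_fin ?csq_ge0//.
Qed.

Lemma sqnormE f : L2 m f -> (\int[m]_x (csq (f x))%:E)%E = (sqnorm f)%:E.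
Proof.
move=> [_ foo]; rewrite /sqnorm /Rintegral fineK// ge0_fin_numE//.
by apply: integral_ge0 => x _; rewrite lee_fin csq_ge0.
Qed.

Lemma sqnorm_ge0 f : 0 <= sqnorm f.
Proof. by apply: Rintegral_ge0 => x _; exact: csq_ge0. Qed.

Lemma L2D f g : L2 m f -> L2 m g -> L2 m (fun x => f x + g x).
Proof.
move=> Lf Lg; have [mf foo] := Lf; have [mg goo] := Lg.
have mfg := cmeasurableD mf mg; split => //.
have I := integrableZl measurableT 2
  (integrableD measurableT (L2_integrable Lf) (L2_integrable Lg)).
have /integrableP[_] := I; apply: le_lt_trans.
apply: ge0_le_integral => //.
- by move=> x _; rewrite lee_fin csq_ge0.
- exact/measurable_EFinP/measurable_csq.
- by apply: measurableT_comp => //; exact: measurable_int I.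
- move=> x _ /=; rewrite lee_fin (le_trans (csqD_le _ _))//.
  by rewrite ler_norm.
Qed.

Lemma L2Z a f : L2 m f -> L2 m (fun x => a * f x).
Proof.
move=> Lf; have [mf foo] := Lf; split; first exact: (cmeasurableM (cmeasurable_cst a)).
under eq_integral do rewrite csqM EFinM.
rewrite ge0_integralZl_EFin ?csq_ge0//; last 2 first.
- by move=> x _; rewrite lee_fin csq_ge0.
- exact/measurable_EFinP/measurable_csq.
by rewrite (sqnormE Lf) -EFinM ltry.
Qed.

Lemma dot_integrable f g : L2 m f -> L2 m g ->
  m.-integrable setT (EFin \o (fun x => complex.Re (f x * conjc (g x)))) /\
  m.-integrable setT (EFin \o (fun x => complex.Im (f x * conjc (g x)))).
Proof.
move=> Lf Lg; have [mf foo] := Lf; have [mg goo] := Lg.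
have I := integrableD measurableT (L2_integrable Lf) (L2_integrable Lg).
have [mr mi] := cmeasurableM mf (cmeasurable_conj mg).
split; apply: (le_integrable measurableT _ _ I).
- exact/measurable_EFinP.
- move=> x _ /=; rewrite lee_fin [leRHS]ger0_norm ?addr_ge0 ?csq_ge0//.
  rewrite !csqE !complex_partsE ler_norml.
  case: (f x) (g x) => [p q] [r s] /=.
  have := sqr_ge0 (p - r); have := sqr_ge0 (p + r).
  have := sqr_ge0 (q - s); have := sqr_ge0 (q + s); nra.
- exact/measurable_EFinP.
- move=> x _ /=; rewrite lee_fin [leRHS]ger0_norm ?addr_ge0 ?csq_ge0//.
  rewrite !csqE !complex_partsE ler_norml.
  case: (f x) (g x) => [p q] [r s] /=.
  have := sqr_ge0 (p - s); have := sqr_ge0 (p + s).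
  have := sqr_ge0 (q - r); have := sqr_ge0 (q + r); nra.
Qed.

Lemma dotDZl a f h g : L2 m f -> L2 m h -> L2 m g ->
  dot (fun x => f x + a * h x) g = dot f g + a * dot h g.
Proof.
move=> Lf Lh Lg.
have [fr fi] := dot_integrable Lf Lg; have [hr hi] := dot_integrable Lh Lg.
have Z (k : R) (u : T -> R) : m.-integrable setT (EFin \o u) ->
    m.-integrable setT (EFin \o (fun x => k * u x)).
  by move=> iu; have := integrableZl measurableT k iu; apply: eq_integrable => // x _.
have B (u v : T -> R) : m.-integrable setT (EFin \o u) -> m.-integrable setT (EFin \o v) ->
    m.-integrable setT (EFin \o (fun x => u x - v x)).
  by move=> iu iv; have := integrableB measurableT iu iv; apply: eq_integrable => // x _.
have D (u v : T -> R) : m.-integrable setT (EFin \o u) -> m.-integrable setT (EFin \o v) ->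
    m.-integrable setT (EFin \o (fun x => u x + v x)).
  by move=> iu iv; have := integrableD measurableT iu iv; apply: eq_integrable => // x _.
have ar k := Z k _ hr; have ai k := Z k _ hi.
apply: complexP; rewrite !complex_partsE /L2dot /cintegral /=.
- under eq_Rintegral => x _ do rewrite mulrDl -mulrA complexReD (complexReM a).
  rewrite RintegralD//; last exact: B.
  by rewrite RintegralB// !RintegralZl.
- under eq_Rintegral => x _ do rewrite mulrDl -mulrA complexImD (complexImM a).
  rewrite RintegralD//; last exact: D.
  by rewrite RintegralD// !RintegralZl.
Qed.

Lemma dotZl a h g : L2 m h -> L2 m g -> dot (fun x => a * h x) g = a * dot h g.
Proof.
move=> Lh Lg; have -> : (fun x => a * h x) = (fun x => h x + (a - 1) * h x).
  by apply/funext => x; rewrite mulrBl mul1r addrC subrK.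
by rewrite (dotDZl _ Lh Lh Lg) mulrBl mul1r addrC subrK.
Qed.

Lemma dot_conj f g : L2 m f -> L2 m g -> dot g f = conjc (dot f g).
Proof.
move=> Lf Lg; have [fr fi] := dot_integrable Lf Lg.
apply: complexP; rewrite !complex_partsE /L2dot /cintegral /=.
  by apply: eq_Rintegral => x _; rewrite !complex_partsE; ring.
rewrite -mulN1r -RintegralZl//.
by apply: eq_Rintegral => x _; rewrite !complex_partsE; ring.
Qed.

Lemma dot_self f : L2 m f -> dot f f = Complex (sqnorm f) 0.
Proof.
move=> Lf; apply: complexP; rewrite /L2dot /cintegral /=.
  by apply: eq_Rintegral => x _; rewrite !complex_partsE csqE; ring.
transitivity (\int[m]_x (cst 0 x) : R).
  by apply: eq_Rintegral => x _; rewrite !complex_partsE /=; ring.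
by rewrite /Rintegral integral0.
Qed.

Lemma sqnormDZ a f h : L2 m f -> L2 m h ->
  sqnorm (fun x => f x + a * h x) =
  sqnorm f + 2 * complex.Re (conjc a * dot f h) + csq a * sqnorm h.
Proof.
move=> Lf Lh; have Lah := L2Z a Lh; have Lfh : L2 m (fun x => f x + a * h x) by exact: L2D.
have := dotDZl a Lf Lh Lfh.
rewrite (dot_self Lfh) (dot_conj Lfh Lf) (dot_conj Lfh Lh) !dotDZl//.
rewrite (dot_self Lf) (dot_self Lh) (dot_conj Lf Lh) => /(congr1 (@complex.Re R)).
by rewrite csqE !complex_partsE /= => ->; ring.
Qed.

(** The squared norm of [f - s <f, h> h] is a nonnegative quadratic polynomial in
    the real parameter [s]. *)
Lemma cauchy_schwarz f h : L2 m f -> L2 m h -> csq (dot f h) <= sqnorm f * sqnorm h.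
Proof.
move=> Lf Lh; set c := dot f h.
have H (s : R) : 0 <= sqnorm f - 2 * s * csq c + s ^+ 2 * csq c * sqnorm h.
  rewrite (_ : _ + _ = sqnorm (fun x => f x + Complex (- s) 0 * c * h x)) ?sqnorm_ge0//.
  by rewrite sqnormDZ// -/c !csqE !complex_partsE /=; ring.
move: (csq c) (csq_ge0 c) H => q q0 H.
have [h0|h0] := eqVneq (sqnorm h) 0.
  rewrite h0 mulr0 leNgt; apply/negP => c0.
  have := H ((sqnorm f + 1) / (2 * q)); rewrite h0 mulr0 addr0.
  have -> : 2 * ((sqnorm f + 1) / (2 * q)) * q = sqnorm f + 1.
    by field; rewrite gt_eqF.
  lra.
have hp : 0 < sqnorm h by rewrite lt_neqAle eq_sym h0 sqnorm_ge0.
have := H (sqnorm h)^-1.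
rewrite (_ : _ + _ = sqnorm f - q / sqnorm h); last by field.
by rewrite subr_ge0 ler_pdivrMr.
Qed.

Definition L2_orthonormal k (F : nat -> T -> R[i]) :=
  (forall i, (i < k)%N -> L2 m (F i)) /\
  forall i j, (i < k)%N -> (j < k)%N -> dot (F i) (F j) = (i == j)%:R.

Lemma orthonormalS k F : L2_orthonormal k.+1 F -> L2_orthonormal k F.
Proof. by move=> [L O]; split=> [i ik|i j ik jk]; [apply: L|apply: O]; exact: ltnW. Qed.

(** Subtracting from [e] its component along the last vector lowers the squared
    norm by that term and leaves the other coefficients unchanged. *)
Lemma bessel k F e : L2_orthonormal k F -> L2 m e ->
  \sum_(i < k) csq (dot (F i) e) <= sqnorm e.
Proof.
elim: k e => [|k IH] e O Le; first by rewrite big_ord0 sqnorm_ge0.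
have [LF OF] := O; have LFk := LF _ (ltnSn k).
pose c := dot e (F k).
have Le' : L2 m (fun x => e x + (- c) * F k x) by apply: L2D => //; exact: L2Z.
have sumE : \sum_(i < k) csq (dot (F i) (fun x => e x + (- c) * F k x)) =
    \sum_(i < k) csq (dot (F i) e).
  apply: eq_bigr => i _; have LFi := LF i (ltnW (ltn_ord i)).
  rewrite (dot_conj Le' LFi) dotDZl// OF ?ltnS ?(ltnW (ltn_ord i))//.
  by rewrite gtn_eqF// mulr0 addr0 csq_conj (dot_conj Le LFi) csq_conj.
have := IH _ (orthonormalS O) Le'; rewrite sumE sqnormDZ// -/c.
have -> : sqnorm (F k) = 1.
  by have := OF k k (ltnSn k) (ltnSn k); rewrite eqxx dot_self// => -[].
have -> : \sum_(i < k.+1) csq (dot (F i) e) =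
    \sum_(i < k) csq (dot (F i) e) + csq (dot (F k) e) by rewrite big_ord_recr.
rewrite [in csq (dot (F k) e)](dot_conj Le LFk) csq_conj -/c.
by rewrite csqN csqE !complex_partsE /=; lra.
Qed.

(** One step of the Gram-Schmidt process.  The last clause says that the part
    removed from [g] is invisible to whatever is orthogonal to the family, without
    naming its coefficients. *)
Lemma orthogonal_part k F g : L2_orthonormal k F -> L2 m g -> exists h,
  [/\ L2 m h, forall i, (i < k)%N -> dot h (F i) = 0 &
    forall e, L2 m e -> (forall i, (i < k)%N -> dot (F i) e = 0) -> dot h e = dot g e].
Proof.
elim: k => [|k IH] O Lg; first by exists g; split.
have [LF OF] := O; have LFk := LF _ (ltnSn k).
have [h [Lh hF hg]] := IH (orthonormalS O) Lg.
pose c := dot h (F k).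
exists (fun x => h x + (- c) * F k x); split.
- by apply: L2D => //; exact: L2Z.
- move=> i; rewrite ltnS leq_eqVlt => /orP[/eqP->|ik].
    by rewrite dotDZl// OF// eqxx mulr1 subrr.
  have LFi : L2 m (F i) by apply: LF; rewrite ltnS ltnW.
  by rewrite dotDZl// hF// OF ?ltnS ?(ltnW ik)// gtn_eqF// mulr0 addr0.
- move=> e Le Fe; rewrite dotDZl// Fe// mulr0 addr0.
  by apply: hg => // i ik; apply: Fe; rewrite ltnS ltnW.
Qed.

(** The vector [e], orthogonal to the family but not to [g], witnesses that [g] is
    not in its span. *)
Lemma orthonormal_extend k F g e : L2_orthonormal k F -> L2 m g -> L2 m e ->
  (forall i, (i < k)%N -> dot (F i) e = 0) -> dot g e != 0 ->
  exists F', L2_orthonormal k.+1 F' /\ forall e', L2 m e' ->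
    (forall i, (i < k)%N -> dot (F i) e' = 0) -> dot g e' = 0 ->
    forall i, (i < k.+1)%N -> dot (F' i) e' = 0.
Proof.
move=> O Lg Le Fe ge; have [LF OF] := O.
have [h [Lh hF hg]] := orthogonal_part O Lg.
have hp : 0 < sqnorm h.
  rewrite lt_neqAle sqnorm_ge0 andbT eq_sym; apply/eqP => h0.
  have := cauchy_schwarz Lh Le; rewrite h0 mul0r hg// => c0.
  have : csq (dot g e) == 0 by rewrite eq_le c0 csq_ge0.
  by rewrite csq_eq0 (negbTE ge).
pose s : R[i] := Complex (Num.sqrt (sqnorm h))^-1 0.
have Z f : L2 m f -> dot (fun x => s * h x) f = s * dot h f by exact: dotZl.
have Lsh := L2Z s Lh.
exists (fun i => if (i < k)%N then F i else (fun x => s * h x)); split; last first.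
  move=> e' Le' Fe' ge' i _; case: ifPn => [|_]; first exact: Fe'.
  by rewrite Z// hg// ge' mulr0.
have D0 i : (i < k)%N -> dot (fun x => s * h x) (F i) = 0.
  by move=> ik; rewrite Z ?hF ?mulr0//; exact: LF.
split=> [i|i j].
  by rewrite ltnS leq_eqVlt => /orP[/eqP->|ik]; [rewrite ltnn|rewrite ik; exact: LF].
rewrite ltnS leq_eqVlt => /orP[/eqP->|ik];
  rewrite ltnS leq_eqVlt => /orP[/eqP->|jk]; rewrite ?ltnn.
- rewrite eqxx Z// (dot_conj Lsh Lh) Z// (dot_self Lh).
  apply: complexP; rewrite !complex_partsE /=; last ring.
  transitivity ((Num.sqrt (sqnorm h))^-1 ^+ 2 * sqnorm h); first by ring.
  rewrite -{2}(sqr_sqrtr (ltW hp)) exprVn mulVf//.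
  by rewrite sqrf_eq0 gt_eqF// sqrtr_gt0.
- by rewrite jk D0// gtn_eqF.
- rewrite ik (dot_conj Lsh (LF _ ik)) D0// ltn_eqF//.
  by apply: complexP; rewrite ?complex_partsE //= oppr0.
- by rewrite ik jk; exact: OF.
Qed.

End L2Algebra.

(** * Characters, time-frequency shifts and the Gabor transform *)

Section Characters.
Variables (R : realType) (G : topologicalZmodType).
Implicit Types (c : character R G) (x y : G).

Lemma character_csq c x : csq (c x) = 1.
Proof.
have : `|c x| = 1 by exact: character_norm.
rewrite normc_def => -[]; rewrite csqE => /(congr1 (fun r => r ^+ 2)).
by rewrite sqr_sqrtr ?addr_ge0 ?sqr_ge0// expr1n.
Qed.

Lemma character_opp c x : c (- x) = conjc (c x).
Proof.
have c0 : c 0 = 1.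
  by apply: (mulfI (character_neq0 c 0)); rewrite -characterD addr0 mulr1.
apply: (mulfI (character_neq0 c x)); rewrite -characterD subrr c0.
have := character_csq c x; rewrite csqE => h.
apply: complexP; rewrite !complex_partsE.
  by transitivity (complex.Re (c x) ^+ 2 + complex.Im (c x) ^+ 2); [rewrite h|ring].
by transitivity (0 : R); [|ring].
Qed.

Lemma csq_lt z (e : R) : 0 < e -> `|z| < (Num.sqrt e)%:C%C -> csq z < e :> R.
Proof.
move=> e0; rewrite normc_def ltcR csqE ltr_sqrt//.
Qed.

Lemma character_cmeasurable c : cmeasurable (c : borel G -> R[i]).
Proof.
have cc (x : G) (e : R) : 0 < e -> \forall y \near x, `|c x - c y| < e%:C%C.
  move=> e0; have := @character_continuous _ _ c x => /cvgrPdist_lt.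
  by apply; rewrite ltcR.
split.
- apply: (@continuous_borel _ _ (fun x => complex.Re (c x))) => x.
  apply/cvgrPdist_lt => e e0; have := cc x e e0; apply: filterS => y cxy.
  by rewrite -complexReB -ltcR; apply: le_lt_trans cxy; exact: normc_ge_Re.
- apply: (@continuous_borel _ _ (fun x => complex.Im (c x))) => x.
  apply/cvgrPdist_lt => e e0; have := cc x e e0; apply: filterS => y cxy.
  rewrite -complexImB -ltcR; apply: le_lt_trans cxy.
  rewrite normc_def lecR -sqrtr_sqr ler_sqrt ?addr_ge0 ?sqr_ge0//.
  by rewrite lerDr sqr_ge0.
Qed.

Lemma character_hausdorff : hausdorff_space (character R G).
Proof.
rewrite open_hausdorff => c1 c2 c12.
have [x cx] : exists x, c1 x != c2 x.
  apply: contrapT => /forallNP no; move/eqP: c12; apply; apply: character_inj => x.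
  by apply/eqP; apply: contrapT => /negP; exact: no.
pose e := `|c1 x - c2 x| / 2.
have e0 : 0 < e by rewrite divr_gt0// normr_gt0 subr_eq0.
have nb c : nbhs c [set c' : character R G | `|c x - c' x| < e].
  apply/nbhs_characterP; exists [set x], e; split => //; first exact: compact_set1.
  by move=> c' /= h; exact: h.
exists ([set c' : character R G | `|c1 x - c' x| < e]°,
        [set c' : character R G | `|c2 x - c' x| < e]°) => /=.
  by split; rewrite inE; exact: nb.
split; try exact: open_interior.
apply/eqP; rewrite -subset0 => c' [/interior_subset /= h1 /interior_subset /= h2].
have /lt_geF := ltrD h1 h2; rewrite -splitr [`|c2 x - _|]distrC.
by rewrite ler_distD.
Qed.

End Characters.

Section Gabor.
Variables (R : realType) (G : topologicalZmodType).
Variable m : {measure set (borel G) -> \bar R}.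
Hypotheses (hG : hausdorff_space G) (sG : @second_countable G)
  (lG : locally_compact [set: G]).
Hypothesis haar_m : haar_measure m.
Implicit Types (f psi : borel G -> R[i]) (c : character R G) (x t : G).

Local Notation dot := (L2dot m).

Definition translate t f : borel G -> R[i] := fun y => f (- t + (y : G)).

(** The time-frequency shift of the window by [x] and [c]. *)
Definition atom psi x c : borel G -> R[i] := fun y => translate x psi y * c y.

Lemma cmeasurable_translate t f : cmeasurable f -> cmeasurable (translate t f).
Proof.
move=> [fr fi].
by split; [exact: (measurable_translate t fr)|exact: (measurable_translate t fi)].
Qed.

Lemma integral_csq_translate t f : cmeasurable f ->
  (\int[m]_y (csq (translate t f y))%:E = \int[m]_y (csq (f y))%:E)%E.
Proof.
move=> mf; rewrite -(ge0_integral_translation haar_m (- t) (f := fun y => (csq (f y))%:E))//.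
- exact/measurable_EFinP/measurable_csq.
- by move=> y; rewrite lee_fin csq_ge0.
Qed.

Lemma L2_translate t f : L2 m f -> L2 m (translate t f).
Proof.
move=> [mf foo]; split; first exact: cmeasurable_translate.
by rewrite integral_csq_translate.
Qed.

Lemma sqnorm_translate t f : L2 m f -> sqnorm m (translate t f) = sqnorm m f.
Proof. by move=> [mf foo]; rewrite /sqnorm /Rintegral integral_csq_translate. Qed.

Lemma csq_atom psi x c y : csq (atom psi x c y) = csq (translate x psi y).
Proof. by rewrite csqM character_csq mulr1. Qed.

Lemma L2_atom psi x c : L2 m psi -> L2 m (atom psi x c).
Proof.
move=> /(L2_translate x)[mp poo]; split.
  by apply: cmeasurableM => //; exact: character_cmeasurable.
by under eq_integral do rewrite csq_atom.
Qed.

Lemma sqnorm_atom psi x c : L2 m psi -> sqnorm m (atom psi x c) = sqnorm m psi.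
Proof.
move=> Lp; rewrite -(sqnorm_translate x Lp); apply: eq_Rintegral => y _.
exact: csq_atom.
Qed.

Lemma gaborE psi f x c : gabor m psi f x c = dot f (atom psi x c).
Proof.
rewrite /gabor /L2dot; congr (cintegral m _); apply/funext => y.
by rewrite character_opp /atom /translate rmorphM /= mulrA.
Qed.

(** Outside a compact set [K] the weight [g] has small mass and [|c' - c| <= 2]; on
    [K] the compact-open topology makes [c' - c] uniformly small. *)
Lemma character_near (g : borel G -> R) c (e : R) :
  measurable_fun setT g -> (forall y, 0 <= g y) -> (\int[m]_y (g y)%:E < +oo)%E ->
  0 < e -> \forall c' \near c,
    (\int[m]_y (g y * csq ((c' : character R G) y - c y))%:E < e%:E)%E.
Proof.
move=> mg g0 goo e0.
have mgE : measurable_fun setT (fun y => (g y)%:E) by exact/measurable_EFinP.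
have gE0 y : (0 <= (g y)%:E)%E by rewrite lee_fin.
have If : (\int[m]_y (g y)%:E)%E \is a fin_num.
  by rewrite ge0_fin_numE// integral_ge0.
set I := fine (\int[m]_y (g y)%:E)%E.
have I0 : 0 <= I by rewrite fine_ge0// integral_ge0.
have e8 : 0 < e / 8 by lra.
have [K cK gK] := integral_compact_tail hG sG lG mgE gE0 goo e8.
(* the [+ 1] guards against [I = 0] *)
pose n := e / (2 * (I + 1)).
have n0 : 0 < n by rewrite divr_gt0//; lra.
apply/nbhs_characterP; exists K, (Num.sqrt n)%:C%C; split => //.
  by rewrite ltcR sqrtr_gt0.
move=> c' /= c'K.
have mK : measurable (~` K : set (borel G)).
  by apply: measurableC; exact: compact_borel.
pose h := (fun y => (g y)%:E) \_ (~` K : set (borel G)).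
have mh : measurable_fun setT h.
  by apply: (iffLR (measurable_restrictT _ mK)); exact: measurable_funTS.
have h0 y : (0 <= h y)%E by rewrite /h patchE; case: ifP.
have mc : measurable_fun setT (fun y : borel G => csq (c' y - c y)).
  apply: measurable_csq; have [c1r c1i] := character_cmeasurable c'.
  have [c2r c2i] := character_cmeasurable c; split.
    by under eq_fun do rewrite complexReB; exact: measurable_funB.
  by under eq_fun do rewrite complexImB; exact: measurable_funB.
have csq4 y : csq (c' y - c y) <= 4.
  by rewrite (le_trans (csqD_le _ _))// csqN !character_csq; lra.
apply: (@le_lt_trans _ _ (\int[m]_y (n%:E * (g y)%:E + 4%:E * h y))%E).
  apply: ge0_le_integral => //.
  - by move=> y _; rewrite lee_fin mulr_ge0 ?csq_ge0.
  - by apply/measurable_EFinP; exact: measurable_funM.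
  - by apply: emeasurable_funD; exact: measurable_funeM.
  - move=> y _; have [Ky|Ky] := pselect (K y).
      rewrite -[leLHS]adde0; apply: leeD; last by rewrite mule_ge0.
      rewrite -EFinM lee_fin mulrC ler_wpM2r//; apply/ltW/csq_lt => //.
      by rewrite distrC; exact: c'K.
    rewrite /h patchE mem_set// -[leLHS]add0e; apply: leeD.
      by rewrite -EFinM lee_fin mulr_ge0// ltW.
    by rewrite -EFinM lee_fin mulrC ler_wpM2r.
rewrite ge0_integralD//; last 4 first.
- by move=> y _; rewrite mule_ge0// lee_fin ltW.
- exact: measurable_funeM.
- by move=> y _; rewrite mule_ge0.
- exact: measurable_funeM.
rewrite !ge0_integralZl_EFin//; last exact: ltW.
rewrite /h -integral_mkcond -(fineK If) -/I.
have -> : (e%:E = (e / 2)%:E + 4%:E * (e / 8)%:E)%E.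
  by rewrite -EFinM -EFinD; congr EFin; lra.
apply: lee_ltD => //.
- rewrite -EFinM lee_fin /n -mulrA -[leRHS]mulr1 invfM.
  have -> : e * (2^-1 * (I + 1)^-1 * I) = e / 2 * (I / (I + 1)) by ring.
  rewrite ler_wpM2l ?divr_ge0 ?(ltW e0)//.
  by rewrite ler_pdivrMr ?mul1r; lra.
- by rewrite lte_pmul2l.
Qed.

End Gabor.

#[local] Arguments ComplexField.Normc.normc : simpl never.

Section GaborContinuity.
Variables (R : realType) (G : topologicalZmodType).
Variable m : {measure set (borel G) -> \bar R}.
Hypotheses (hG : hausdorff_space G) (sG : @second_countable G)
  (lG : locally_compact [set: G]).
Hypothesis haar_m : haar_measure m.
Implicit Types (f psi : borel G -> R[i]) (c : character R G) (x t : G).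

Local Notation dot := (L2dot m).

Lemma cmeasurableB f g : cmeasurable f -> cmeasurable g ->
  cmeasurable (fun y => f y - g y).
Proof.
move=> [fr fi] [gr gi]; split.
  by under eq_fun do rewrite complexReB; exact: measurable_funB.
by under eq_fun do rewrite complexImB; exact: measurable_funB.
Qed.

Lemma L2B f g : L2 m f -> L2 m g -> L2 m (fun y => f y - g y).
Proof.
move=> Lf Lg; have := L2D Lf (L2Z (- 1) Lg).
by congr (L2 m _); apply/funext => y; rewrite mulN1r.
Qed.

Lemma dotBr f g h : L2 m f -> L2 m g -> L2 m h ->
  dot f (fun y => g y - h y) = dot f g - dot f h.
Proof.
move=> Lf Lg Lh; have Lgh := L2B Lg Lh.
rewrite (dot_conj Lgh Lf) (dot_conj Lg Lf) (dot_conj Lh Lf).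
have -> : (fun y => g y - h y) = (fun y => g y + (- 1) * h y).
  by apply/funext => y; rewrite mulN1r.
by rewrite (dotDZl (- 1) Lg Lh Lf) mulN1r rmorphB.
Qed.

(** The change of [x] is controlled by the continuity of translations in [L2], and
    the change of [c] by [character_near] with the weight [|psi (- x + y)|^2]. *)
Lemma atom_near psi x c (e : R) : L2 m psi -> 0 < e ->
  \forall z \near (x, c),
    (\int[m]_y (csq (atom psi z.1 z.2 y - atom psi x c y))%:E < e%:E)%E.
Proof.
move=> Lp e0; have e4 : 0 < e / 4 by lra.
have Lpx := L2_translate haar_m x Lp.
have [mp poo] := Lp; have [mpx pxoo] := Lpx.
have near1 : \forall x' \near x,
    (\int[m]_y (csq (translate x' psi y - translate x psi y))%:E < (e / 4)%:E)%E.
  have := @translation_continuous G (- x) x; rewrite /continuous_at addNr => cx.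
  have : \forall x' \near x,
      (\int[m]_y (csq (psi (- (- x + x') + (y : G)) - psi y))%:E < (e / 4)%:E)%E.
    exact: (cx _ (translation_continuousL2 haar_m hG Lp e4)).
  apply: filterS => x'.
  rewrite -(ge0_integral_translation haar_m (- x)
    (f := fun y : borel G => (csq (psi (- (- x + x') + (y : G)) - psi y))%:E)).
  - apply: le_lt_trans; rewrite le_eqVlt; apply/orP; left; apply/eqP.
    by apply: eq_integral => y _; rewrite /translate opprD opprK addrACA subrr add0r.
  - apply/measurable_EFinP; apply: measurable_csq; apply: cmeasurableB => //.
    exact: (cmeasurable_translate (- x + x')).
  - by move=> y; rewrite lee_fin csq_ge0.
have near2 := character_near hG sG lG c (measurable_csq mpx) (fun y => csq_ge0 _) pxoo e4.
exists ([set x' | (\int[m]_y (csq (translate x' psi y - translate x psi y))%:E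
     < (e / 4)%:E)%E],
  [set c' : character R G | (\int[m]_y (csq (translate x psi y) *
     csq ((c' : character R G) y - c y))%:E < (e / 4)%:E)%E]); first by split.
move=> [x' c'] [/= hx' hc'].
pose u y := csq (translate x' psi y - translate x psi y).
pose v y := csq (translate x psi y) * csq ((c' : character R G) y - c y).
have mx' : cmeasurable (translate x' psi) by exact: cmeasurable_translate.
have mu : measurable_fun setT (fun y => (u y)%:E).
  by apply/measurable_EFinP; apply: measurable_csq; exact: cmeasurableB.
have mc c1 := character_cmeasurable c1.
have mv : measurable_fun setT (fun y => (v y)%:E).
  apply/measurable_EFinP; apply: measurable_funM; first exact: measurable_csq.
  by apply: measurable_csq; apply: cmeasurableB; exact: mc.
have u0 y : (0 <= (u y)%:E)%E by rewrite lee_fin csq_ge0.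
have v0 y : (0 <= (v y)%:E)%E by rewrite lee_fin mulr_ge0 ?csq_ge0.
apply: (@le_lt_trans _ _ (\int[m]_y (2%:E * ((u y)%:E + (v y)%:E)))%E).
  apply: ge0_le_integral => //.
  - by move=> y _; rewrite lee_fin csq_ge0.
  - apply/measurable_EFinP; apply: measurable_csq; apply: cmeasurableB;
      by apply: cmeasurableM => //; exact: mc.
  - by apply: measurable_funeM; exact: emeasurable_funD.
  - move=> y _; rewrite -EFinD -EFinM lee_fin /atom.
    have -> : translate x' psi y * c' y - translate x psi y * c y =
        (translate x' psi y - translate x psi y) * c' y +
        translate x psi y * (c' y - c y) by ring.
    by rewrite (le_trans (csqD_le _ _))// !csqM character_csq mulr1.
rewrite ge0_integralZl_EFin//; last 2 first.
  by move=> y _; exact: adde_ge0.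
  exact: emeasurable_funD.
rewrite ge0_integralD//.
have -> : (e%:E = 2%:E * ((e / 4)%:E + (e / 4)%:E))%E.
  by rewrite -EFinD -EFinM; congr EFin; lra.
by rewrite lte_pmul2l//; exact: lteD.
Qed.

Lemma gabor_near psi f x c (e : R) : L2 m psi -> L2 m f -> 0 < e ->
  \forall z \near (x, c), csq (gabor m psi f z.1 z.2 - gabor m psi f x c) < e.
Proof.
move=> Lp Lf e0.
have d0 : 0 < e / (sqnorm m f + 1).
  by rewrite divr_gt0// ltr_wpDl// sqnorm_ge0.
have := atom_near x c Lp d0; apply: filterS => -[x' c'] /= h.
have La := L2_atom haar_m x' c' Lp; have Lb := L2_atom haar_m x c Lp.
rewrite !gaborE -(dotBr Lf La Lb).
apply: (le_lt_trans (cauchy_schwarz Lf (L2B La Lb))).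
move: h; rewrite (sqnormE (L2B La Lb)) lte_fin ltr_pdivlMr ?ltr_wpDl ?sqnorm_ge0// => h.
apply: le_lt_trans h; rewrite mulrDr mulr1 mulrC lerDl; exact: sqnorm_ge0.
Qed.

Lemma gabor_open psi f : L2 m psi -> L2 m f ->
  open [set z : G * character R G | gabor m psi f z.1 z.2 != 0].
Proof.
move=> Lp Lf; rewrite openE => -[x c] /= V0; rewrite /interior.
have e0 : 0 < csq (gabor m psi f x c).
  by rewrite lt_neqAle eq_sym csq_eq0 V0 csq_ge0.
have := gabor_near x c Lp Lf e0; apply: filterS => -[x' c'] /= h.
by apply/eqP => V'; move: h; rewrite V' sub0r csqN ltxx.
Qed.

Lemma gabor_cmeasurable psi f x : L2 m psi -> L2 m f ->
  cmeasurable (gabor m psi f x : borel (character R G) -> R[i]).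
Proof.
move=> Lp Lf.
have near_c c (e : R) : 0 < e -> \forall c' \near c,
    csq (gabor m psi f x c' - gabor m psi f x c) < e ^+ 2.
  move=> e0; have [] := gabor_near x c Lp Lf (exprn_gt0 2 e0).
  move=> [U V] [/= nU nV] UV; apply: filterS nV => c' Vc'.
  by apply: (UV (x, c')); split => //=; exact: nbhs_singleton.
have sq_lt (a e : R) : 0 < e -> a ^+ 2 < e ^+ 2 -> `|a| < e.
  by move=> e0; rewrite -(real_normK (num_real a)) ltr_pXn2r// nnegrE ltW.
split.
- apply: (@continuous_borel _ _ (fun c => complex.Re (gabor m psi f x c))) => c.
  have Fc : Filter (nbhs (c : character R G)) by exact: nbhs_filter.
  apply/(@cvgrPdist_lt _ _ _ _ Fc) => e e0; have := near_c c e e0; apply: filterS => c' h.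
  rewrite distrC; apply: sq_lt => //; apply: le_lt_trans h.
  by rewrite csqE complexReB lerDl sqr_ge0.
- apply: (@continuous_borel _ _ (fun c => complex.Im (gabor m psi f x c))) => c.
  have Fc : Filter (nbhs (c : character R G)) by exact: nbhs_filter.
  apply/(@cvgrPdist_lt _ _ _ _ Fc) => e e0; have := near_c c e e0; apply: filterS => c' h.
  rewrite distrC; apply: sq_lt => //; apply: le_lt_trans h.
  by rewrite csqE complexImB lerDr sqr_ge0.
Qed.

Lemma cintegral_translate (F : borel G -> R[i]) t : cmeasurable F ->
  cintegral m (fun y => F (t + (y : G))) = cintegral m F.
Proof.
move=> [Fr Fi]; rewrite /cintegral /Rintegral.
have mE (u : borel G -> R) : measurable_fun setT u -> measurable_fun setT (EFin \o u).
  by move=> mu; exact/measurable_EFinP.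
congr Complex; congr fine.
  exact: (integral_translation haar_m t (mE _ Fr)).
exact: (integral_translation haar_m t (mE _ Fi)).
Qed.

Lemma gabor_translate psi f x c t : L2 m psi -> L2 m f ->
  gabor m psi f (- t + x) c = conjc (c (- t)) * gabor m psi (translate t f) x c.
Proof.
move=> Lp Lf; rewrite !gaborE.
have Lt := L2_translate haar_m t Lf; have La := L2_atom haar_m x c Lp.
rewrite -(dotZl _ Lt La) /L2dot.
have [mf _] := Lf; have [ma _] := L2_atom haar_m (- t + x) c Lp.
rewrite -(cintegral_translate (- t) (cmeasurableM mf (cmeasurable_conj ma))).
congr (cintegral m _); apply/funext => y.
rewrite /atom /translate characterD !rmorphM /= opprD opprK.
by rewrite addrACA subrr add0r; ring.
Qed.

End GaborContinuity.

(** * Energy of the Gabor transform *)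

Lemma sqnorm_eq0 d (T : measurableType d) (R : realType) (m : {measure set T -> \bar R})
  (f : T -> R[i]) : L2 m f -> sqnorm m f = 0 -> ae_eq m setT f (cst 0).
Proof.
move=> Lf f0; have [mf _] := Lf.
have mE : measurable_fun setT (fun x => (csq (f x))%:E).
  exact/measurable_EFinP/measurable_csq.
have [H _] := ae_eq_integral_abs m measurableT mE.
have := sqnormE Lf; rewrite f0 => I0.
have : ae_eq m setT (fun x => (csq (f x))%:E) (cst 0%E).
  apply: H; rewrite -[RHS]I0; apply: eq_integral => x _.
  by rewrite gee0_abs// lee_fin csq_ge0.
apply: filterS => x h xT; have := h xT => /= -[] /eqP.
by rewrite csq_eq0 => /eqP.
Qed.

Import ComplexField.Normc.

Lemma normc_ge0 (R : realType) (z : R[i]) : 0 <= normc z.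
Proof. by case: z => a b; exact: sqrtr_ge0. Qed.

Lemma normc_conj (R : realType) (z : R[i]) : normc (conjc z) = normc z.
Proof. by case: z => a b; rewrite /normc /= sqrrN. Qed.

Section GaborEnergy.
Variables (R : realType) (G : topologicalZmodType).
Variables (m : {measure set (borel G) -> \bar R})
  (mu : {measure set (borel (character R G)) -> \bar R}).
Hypotheses (hG : hausdorff_space G) (sG : @second_countable G)
  (lG : locally_compact [set: G]).
Hypotheses (haar_m : haar_measure m) (plancherel_mu : plancherel_measure m mu).
Implicit Types (f psi : borel G -> R[i]) (c : character R G) (x t : G).

Local Notation dot := (L2dot m).

Lemma plancherel_isometry h : L1 m h -> L2 m h -> cmeasurable (fourier m h) ->
  (\int[mu]_c (csq (fourier m h c))%:E = \int[m]_y (csq (h y))%:E)%E.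
Proof.
move=> L1h L2h mFh; have [_ [U PU]] := plancherel_mu.
have LUh := plancherel_L2 PU L2h; have [mUh _] := LUh.
have := plancherel_dot PU L2h L2h; rewrite (dot_self LUh) (dot_self L2h) => -[E].
rewrite (sqnormE L2h) -E -(sqnormE LUh).
apply: ge0_ae_eq_integral => //.
- exact/measurable_EFinP/measurable_csq.
- exact/measurable_EFinP/measurable_csq.
- by move=> c _; rewrite lee_fin csq_ge0.
- by move=> c _; rewrite lee_fin csq_ge0.
- have := plancherel_fourier PU L1h L2h; apply: filterS => c h1 cT.
  by rewrite (h1 cT).
Qed.

(** The integral of [|gabor m psi f x c|^2] over [c], computed on the side of [G]. *)
Definition energy_at psi f x : \bar R :=
  (\int[m]_y (csq (f y) * csq (translate x psi y))%:E)%E.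

Lemma energy_at_ge0 psi f x : (0 <= energy_at psi f x)%E.
Proof. by apply: integral_ge0 => y _; rewrite lee_fin mulr_ge0 ?csq_ge0. Qed.

(** At a fixed time [x] the Gabor transform is the Fourier transform of
    [f * conj (psi (- x + .))].  This function is always integrable, and it is
    square integrable when its energy is finite, hence for almost every [x]. *)
Lemma gabor_energy_at psi f x : L2 m psi -> L2 m f -> (energy_at psi f x < +oo)%E ->
  (\int[mu]_c (csq (gabor m psi f x c))%:E = energy_at psi f x)%E.
Proof.
move=> Lp Lf foo; pose h : borel G -> R[i] := fun y => f y * conjc (translate x psi y).
have Lpx := L2_translate haar_m x Lp.
have [mf _] := Lf; have [mp _] := Lpx.
have mh : cmeasurable h by apply: cmeasurableM => //; exact: cmeasurable_conj.
have hE y : csq (h y) = csq (f y) * csq (translate x psi y) by rewrite csqM csq_conj.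
have L2h : L2 m h by split => //; under eq_integral do rewrite hE.
have L1h : L1 m h.
  split => //.
  have I := integrableD measurableT (L2_integrable Lf) (L2_integrable Lpx).
  have /integrableP[mI] := I; apply: le_lt_trans.
  apply: ge0_le_integral => //.
  - by move=> y _; rewrite lee_fin normc_ge0.
  - apply/measurable_EFinP; rewrite (_ : (fun y => _) = fun y => Num.sqrt (csq (h y))).
      apply: measurableT_comp; last exact: measurable_csq.
      by apply: continuous_measurable_fun; exact: sqrt_continuous.
    by apply/funext => y; rewrite sqrtr_sqr ger0_norm// normc_ge0.
  - exact: measurableT_comp.
  - move=> y _ /=; rewrite lee_fin [leRHS]ger0_norm ?addr_ge0 ?csq_ge0// normcM normc_conj.
    have := sqr_ge0 (normc (f y) - normc (translate x psi y)).
    by have := sqr_ge0 (normc (f y)); have := sqr_ge0 (normc (translate x psi y)); nra.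
rewrite -[RHS]/(\int[m]_y _)%E; under [RHS]eq_integral do rewrite -hE.
rewrite -(plancherel_isometry L1h L2h); first by [].
exact: (gabor_cmeasurable hG sG lG haar_m x Lp Lf).
Qed.

Lemma energy_total psi f : L2 m psi -> L2 m f ->
  measurable_fun setT (fun x : borel G => energy_at psi f x) /\
  (\int[m]_x energy_at psi f (x : G) = (sqnorm m f * sqnorm m psi)%:E)%E.
Proof.
move=> Lp Lf; have [mf _] := Lf; have [mp _] := Lp.
have sf := haar_sigma_finite haar_m hG sG lG.
pose S1 := isSFinite.Build _ _ _ (m : set (borel G) -> \bar R)
  (sfinite_measure_sigma_finite sf).
pose S2 := isSigmaFinite.Build _ _ _ (m : set (borel G) -> \bar R) sf.
pose m' : {sigma_finite_measure set (borel G) -> \bar R} :=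
  HB.pack (Measure.sort m) S1 S2.
pose g (z : borel G * borel G) := (csq (f ((z.1 : G) + (z.2 : G))) * csq (psi z.2))%:E.
have mg : measurable_fun setT g.
  apply/measurable_EFinP; apply: measurable_funM.
    exact: (measurableT_comp (measurable_csq mf) (@add_borel G sG)).
  exact: (measurableT_comp (measurable_csq mp) measurable_snd).
have g0 z : (0 <= g z)%E by rewrite lee_fin mulr_ge0 ?csq_ge0.
(* with [x + y] for [y], the time [x] only occurs in a translate of [f], whose
   integral over [x] is the squared norm of [f] *)
have sE x : energy_at psi f x = (\int[m']_y g (x, y))%E.
  rewrite /energy_at -(ge0_integral_translation haar_m x).
  - apply: eq_integral => y _; rewrite /g /= /translate.
    by rewrite addKr.
  - apply/measurable_EFinP; apply: measurable_funM; first exact: measurable_csq.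
    by apply: measurable_csq; exact: cmeasurable_translate.
  - by move=> y; rewrite lee_fin mulr_ge0 ?csq_ge0.
split.
  have := measurable_fun_fubini_tonelli_F (m2 := m') g mg g0.
  by apply: eq_measurable_fun => x _; rewrite sE.
under eq_integral do rewrite sE.
rewrite -[LHS]/(\int[m']_x _)%E (fubini_tonelli (m1 := m') (m2 := m') g mg g0).
transitivity (\int[m']_y ((sqnorm m f)%:E * (csq (psi y))%:E))%E.
  apply: eq_integral => y _; rewrite /g /=.
  under eq_integral do rewrite EFinM.
  rewrite ge0_integralZr//.
  - congr (_ * _)%E; rewrite -(sqnormE Lf).
    under eq_integral do rewrite addrC.
    apply: (ge0_integral_translation haar_m y (f := fun y => (csq (f y))%:E)).
      exact/measurable_EFinP/measurable_csq.
    by move=> z; rewrite lee_fin csq_ge0.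
  - apply/measurable_EFinP; under eq_fun do rewrite addrC.
    exact: (measurableT_comp (measurable_csq mf) (@translation_borel G y)).
  - by move=> z _; rewrite lee_fin csq_ge0.
  - by rewrite lee_fin csq_ge0.
rewrite ge0_integralZl_EFin ?sqnorm_ge0//.
- by rewrite -[X in (_ * X)%E]/(\int[m]_y (csq (psi y))%:E)%E (sqnormE Lp) -EFinM.
- by move=> y _; rewrite lee_fin csq_ge0.
- exact/measurable_EFinP/measurable_csq.
Qed.

Local Notation J A := ((m \x mu)%E (A : set (borel G * borel (character R G)))).

(** At each point of [A] Bessel's inequality bounds the sum of the [k] squared
    moduli by the squared norm of the window, which is also the total energy of
    each transform. *)
Lemma gabor_support_bound k F psi (A : set (G * character R G)) :
  L2 m psi -> 0 < sqnorm m psi -> L2_orthonormal m k F -> open A ->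
  (forall i x c, (i < k)%N -> ~ A (x, c) -> gabor m psi (F i) x c = 0) ->
  (k%:R%:E <= J A)%E.
Proof.
move=> Lp p0 O oA FA; have [LF OF] := O.
have haar_mu : haar_measure mu by case: plancherel_mu.
have hH : hausdorff_space (character R G) by exact: character_hausdorff.
have mF := fun i : 'I_k => (energy_total Lp (LF i (ltn_ord i))).1.
have eF := fun i : 'I_k => (energy_total Lp (LF i (ltn_ord i))).2.
have F1 (i : 'I_k) : sqnorm m (F i) = 1.
  have := OF i i (ltn_ord i) (ltn_ord i); rewrite eqxx.
  by rewrite (dot_self (LF i (ltn_ord i))) => -[].
pose Q (x : borel G) : \bar R := (\sum_(i < k) energy_at psi (F i) (x : G))%E.
have Q0 x : (0 <= Q x)%E by apply: sume_ge0 => j _; exact: energy_at_ge0.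
have mQ : measurable_fun setT Q by apply: emeasurable_sum => j; exact: (mF j).
have IQ : (\int[m]_x Q x = (k%:R * sqnorm m psi)%:E)%E.
  rewrite ge0_integral_sum//; last by move=> j y _; exact: energy_at_ge0.
  rewrite (eq_bigr (fun=> (sqnorm m psi)%:E)) => [|j _]; last by rewrite eF F1 mul1r.
  by rewrite sumEFin sumr_const card_ord mulr_natl.
have iQ : m.-integrable setT Q.
  apply/integrableP; split => //.
  by under eq_integral do rewrite gee0_abs//; rewrite IQ ltry.
pose w (x : borel G) := mu (xsection A (x : G)).
have mw : measurable_fun setT w by exact: (section_measurable haar_mu hH).
have w0 x : (0 <= w x)%E by exact: measure_ge0.
have mA x : measurable (xsection A x : set (borel (character R G))).
  by apply: open_borel; exact: open_section.
have QA x : Q x \is a fin_num -> (Q x <= (sqnorm m psi)%:E * w x)%E.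
  move=> Qf.
  have fin (i : 'I_k) : (energy_at psi (F i) x < +oo)%E.
    apply: le_lt_trans (_ : Q x < +oo)%E; last by rewrite ltey_eq Qf.
    rewrite /Q (bigD1 i)//= leeDl// sume_ge0// => j _; exact: energy_at_ge0.
  have mV (i : 'I_k) : measurable_fun setT
      (fun c : borel (character R G) => (csq (gabor m psi (F i) x c))%:E).
    apply/measurable_EFinP/measurable_csq.
    exact: (gabor_cmeasurable hG sG lG haar_m x Lp (LF i (ltn_ord i))).
  have -> : Q x = (\int[mu]_c \sum_(i < k) (csq (gabor m psi (F i) x c))%:E)%E.
    rewrite ge0_integral_sum//; last by move=> j c _; rewrite lee_fin csq_ge0.
    by apply: eq_bigr => j _; rewrite gabor_energy_at//; exact: LF.
  have -> : ((sqnorm m psi)%:E * w x =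
      \int[mu]_c ((sqnorm m psi)%:E *
        (\1_(xsection A x : set (borel (character R G))) c)%:E))%E.
    rewrite ge0_integralZl_EFin ?sqnorm_ge0//.
      by rewrite integral_indic// setIT.
    by apply/measurable_EFinP; exact: measurable_indic.
  apply: ge0_le_integral => //.
  - by move=> c _; apply: sume_ge0 => j _; rewrite lee_fin csq_ge0.
  - by apply: emeasurable_sum => j; exact: (mV j).
  - apply: measurable_funeM; apply/measurable_EFinP; exact: measurable_indic.
  - move=> c _; have [Ac|Ac] := pselect (xsection A x c).
      rewrite indicE mem_set// mule1 sumEFin lee_fin -(sqnorm_atom haar_m x c Lp).
      under eq_bigr do rewrite gaborE.
      by apply: bessel => //; exact: L2_atom.
    rewrite indicE memNset// mule0 big1// => j _.
    rewrite FA//; last by move=> Axc; apply: Ac; exact/xsectionP.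
    by congr EFin; apply/eqP; rewrite csq_eq0.
have QJ : (\int[m]_x Q x <= \int[m]_x ((sqnorm m psi)%:E * w x))%E.
  apply: ae_ge0_le_integral => //.
  - by move=> x _; rewrite mule_ge0// lee_fin sqnorm_ge0.
  - exact: measurable_funeM.
  - have := integrable_ae measurableT iQ; apply: filterS => x h xT.
    by apply: QA; exact: h.
move: QJ; rewrite IQ ge0_integralZl_EFin ?sqnorm_ge0// mulrC EFinM.
by rewrite lee_pmul2l.
Qed.

End GaborEnergy.

(** * Noncompact identity component: the uncertainty principle holds *)

Section NoncompactComponent.
Variables (R : realType) (G : topologicalZmodType).
Variables (m : {measure set (borel G) -> \bar R})
  (mu : {measure set (borel (character R G)) -> \bar R}).
Hypotheses (hG : hausdorff_space G) (sG : @second_countable G)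
  (lG : locally_compact [set: G]).
Hypotheses (haar_m : haar_measure m) (plancherel_mu : plancherel_measure m mu).
Implicit Types (f psi : borel G -> R[i]) (c : character R G) (x t : G).

Local Notation dot := (L2dot m).
Local Notation J A := ((m \x mu)%E (A : set (borel G * borel (character R G)))).

Definition gabor_support psi f : set (G * character R G) :=
  [set z | gabor m psi f z.1 z.2 != 0].

(** The previous bound for the single signal [f / |f|]. *)
Lemma gabor_support_ge1 psi f : L2 m psi -> L2 m f -> 0 < sqnorm m psi ->
  0 < sqnorm m f -> (1 <= J (gabor_support psi f))%E.
Proof.
move=> Lp Lf p0 f0.
have [|||F [oF FV]] := @orthonormal_extend _ _ _ m 0 (fun _ _ => 0) f f _ Lf Lf.
- by split.
- by [].
- by rewrite (dot_self Lf) eq_complex /= negb_and gt_eqF.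
apply: (gabor_support_bound hG sG lG haar_m plancherel_mu Lp p0 oF).
  exact: (gabor_open hG sG lG haar_m Lp Lf).
move=> i x c i1 /negP; rewrite negbK => /eqP V0; rewrite gaborE.
by apply: FV; [exact: L2_atom| |rewrite -gaborE|exact: i1].
Qed.

(** Each new signal is the part of a translate of [f] orthogonal to the previous
    ones.  At a point of the support of the translate outside [A] the previous
    transforms vanish and the new one does not, so this part is not null. *)
Lemma orthonormal_family psi f k : L2 m psi -> L2 m f -> 0 < sqnorm m psi ->
  0 < sqnorm m f -> (J (gabor_support psi f) < +oo)%E ->
  ~ compact (identity_component G) ->
  exists A F, [/\ open A, gabor_support psi f `<=` A,
    (J A < J (gabor_support psi f) + 1)%E, L2_orthonormal m k F &
    forall i x c, (i < k)%N -> ~ A (x, c) -> gabor m psi (F i) x c = 0].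
Proof.
move=> Lp Lf p0 f0; set S := gabor_support psi f => JS ncG.
have haar_mu : haar_measure mu by case: plancherel_mu.
have hH : hausdorff_space (character R G) by exact: character_hausdorff.
have oS : open S by exact: (gabor_open hG sG lG haar_m Lp Lf).
have JS1 : (1 <= J S)%E by exact: gabor_support_ge1.
have JSf : J S \is a fin_num by rewrite ge0_fin_numE// product_ge0.
elim: k => [|k [A [F [oA SA JA O FA]]]].
  exists S, (fun _ _ => 0); split => //.
  by rewrite -(fineK JSf) -EFinD lte_fin ltrDl.
have JAoo : (J A < +oo)%E by apply: lt_trans JA _; rewrite -(fineK JSf) -EFinD ltry.
have JAf : J A \is a fin_num by rewrite ge0_fin_numE// product_ge0.
have JS0 : (0 < J S)%E by apply: lt_le_trans JS1.
(* the room left below the bound [J S + 1] *)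
pose d := fine (J S) + 1 - fine (J A).
have d0 : 0 < d.
  by move: JA; rewrite /d -(fineK JSf) -(fineK JAf) -EFinD lte_fin subr_gt0.
have [|||t /andP[tl tr]] := @small_positive_escape _ _ _ m mu haar_m haar_mu hG hH sG lG S A
    (identity_component G) d oS oA SA JAoo JS0 _ ncG _ _ d0.
- exact: component_closed.
- exact: component_connected.
- exact: connected_component_refl.
have oSt : open (time_shift t S) by exact: open_time_shift.
have oStA : open (time_shift t S `&` A) by exact: openI.
have oU : open (A `|` time_shift t S) by exact: openU.
have [x [c [Sxc Axc]]] : exists x c, time_shift t S (x, c) /\ ~ A (x, c).
  apply: contrapT => no; move: tr; rewrite setIidl ?product_time_shift ?ltxx// => -[x c] Sxc.
  by apply: contrapT => Axc; apply: no; exists x, c.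
have Ltf := L2_translate haar_m t Lf.
have [F' [oF' F'0]] : exists F', L2_orthonormal m k.+1 F' /\ forall e', L2 m e' ->
    (forall i, (i < k)%N -> dot (F i) e' = 0) -> dot (translate t f) e' = 0 ->
    forall i, (i < k.+1)%N -> dot (F' i) e' = 0.
  apply: (orthonormal_extend (e := atom psi x c) O Ltf (L2_atom haar_m x c Lp)).
    by move=> i ik; rewrite -gaborE; exact: FA.
  rewrite -gaborE; apply: contraTneq Sxc => V0.
  rewrite /time_shift /S /gabor_support /=.
  by rewrite (gabor_translate haar_m x c t Lp Lf) V0 mulr0 eqxx.
exists (A `|` time_shift t S), F'; split => //.
- by move=> z Sz; left; exact: SA.
- have : (J (A `|` time_shift t S) + J (time_shift t S `&` A) <= J A + J (time_shift t S))%E.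
    apply: product_le2 => // z; rewrite xsectionI.
    have -> : xsection (A `|` time_shift t S) z =
        xsection A z `|` xsection (time_shift t S) z.
      by rewrite !xsectionE preimage_setU.
    by apply: measureU_modular; apply: open_borel; exact: open_section.
  rewrite product_time_shift// => modular.
  have Jf : J (time_shift t S `&` A) \is a fin_num.
    by rewrite ge0_fin_numE ?product_ge0// (lt_trans tr).
  have JUf : J (A `|` time_shift t S) \is a fin_num.
    rewrite ge0_fin_numE ?product_ge0//.
    apply: (@le_lt_trans _ _ (J A + J S)%E); last first.
      by rewrite -(fineK JSf) -(fineK JAf) -EFinD ltry.
    by apply: le_trans modular; rewrite leeDl// product_ge0.
  move: tl modular; rewrite -(fineK JSf) -(fineK JAf) -(fineK Jf) -(fineK JUf).
  rewrite -EFinN -!EFinD !lte_fin !lee_fin /d; lra.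
- move=> i x' c' ik nU; rewrite gaborE; apply: (F'0 _ (L2_atom haar_m x' c' Lp)) => //.
    move=> j jk; rewrite -gaborE; apply: FA => //.
    by move=> Ax; apply: nU; left.
  rewrite -gaborE; have : ~ time_shift t S (x', c') by move=> Sx; apply: nU; right.
  rewrite /time_shift /S /gabor_support /= => /negP; rewrite negbK.
  rewrite (gabor_translate haar_m x' c' t Lp Lf) mulf_eq0 => /orP[|/eqP//].
  by rewrite -csq_eq0 csq_conj character_csq oner_eq0.
Qed.

Lemma noncompact_gabor_qup : ~ compact (identity_component G) -> gabor_qup m mu.
Proof.
move=> ncG f psi Lf [Lp psi0] JS.
have pos g : L2 m g -> ~ ae_eq m setT g (cst 0) -> 0 < sqnorm m g.
  move=> Lg ng; rewrite lt_neqAle sqnorm_ge0 andbT eq_sym; apply/eqP => g0.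
  by apply: ng; exact: sqnorm_eq0.
apply: contrapT => f0.
have p0 := pos _ Lp psi0; have {}f0 := pos _ Lf f0.
have JSf : J (gabor_support psi f) \is a fin_num.
  by rewrite ge0_fin_numE// product_ge0.
pose k := (Num.truncn (fine (J (gabor_support psi f)) + 1)).+1.
have [A [F [oA SA JA O FA]]] := @orthonormal_family psi f k Lp Lf p0 f0 JS ncG.
have := gabor_support_bound hG sG lG haar_m plancherel_mu Lp p0 O oA FA.
move=> /le_lt_trans/(_ JA); rewrite -(fineK JSf) -EFinD lte_fin ltNge.
by rewrite /k ltW// truncnS_gt.
Qed.

End NoncompactComponent.

(** * Compact identity component: the uncertainty principle fails *)

Section CompactComponent.
Variables (R : realType) (G : topologicalZmodType).
Variables (m : {measure set (borel G) -> \bar R})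
  (mu : {measure set (borel (character R G)) -> \bar R}).
Hypotheses (hG : hausdorff_space G) (sG : @second_countable G)
  (lG : locally_compact [set: G]).
Hypotheses (haar_m : haar_measure m) (plancherel_mu : plancherel_measure m mu).
Implicit Types (c : character R G) (x t : G).

(** If [U] were null, so would be its translates, and countably many basic open
    sets contained in them cover [G]. *)
Lemma haar_open_gt0 (U : set G) : open U -> U 0 -> (0 < m U)%E.
Proof.
move=> oU U0; rewrite lt_neqAle measure_ge0 andbT eq_sym; apply/eqP => mU0.
have [mT _ _ _ _] := haar_m; move/eqP: mT; apply.
have mU : measurable (U : set (borel G)) by exact: open_borel.
have nullx x : m [set y : borel G | U (- x + (y : G))] = 0%E.
  by rewrite (haar_translation haar_m).
have [e [oe be]] := countable_basis_seq sG.
pose P n := exists x, e n `<=` [set y | U (- x + y)].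
apply/measure_negligible; first exact: measurableT.
have -> : [set: borel G] = \bigcup_n (if `[< P n >] then (e n : set (borel G)) else set0).
  rewrite eqEsubset; split=> // x _.
  have nU : nbhs (x : G) [set y | U (- (x : G) + y)].
    apply: (@translation_continuous G (- (x : G)) x U).
    by rewrite addNr; exact: open_nbhs_nbhs.
  have [n [nx nP]] := be _ _ nU; exists n => //.
  by case: asboolP => // nPn; exfalso; apply: nPn; exists x.
apply: negligible_bigcup => n; case: asboolP => [[x xn]|_]; last exact: negligible_set0.
exists [set y : borel G | U (- x + (y : G))]; split => //.
exact: translate_borel.
Qed.

Section CompactOpenSubgroup.
Variable K : set G.
Hypotheses (cK : compact K) (oK : open K) (K0 : K 0)
  (KD : forall x y, K x -> K y -> K (x + y)) (KN : forall x, K x -> K (- x)).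

Definition subgroup_indic : borel G -> R[i] :=
  fun y => Complex (\1_(K : set (borel G)) y) 0.

Local Notation chi := subgroup_indic.
Local Notation KB := (K : set (borel G)).

Let mK : measurable KB. Proof. exact: open_borel. Qed.

Let mKoo : (m KB < +oo)%E. Proof. exact: haar_compact. Qed.

Let mK0 : (0 < m KB)%E. Proof. exact: haar_open_gt0. Qed.

Let mKf : m KB \is a fin_num. Proof. by rewrite ge0_fin_numE. Qed.

Lemma csq_subgroup_indic y : csq (chi y) = \1_KB y.
Proof.
rewrite csqE /= expr0n addr0 /= indicE; case: (_ \in _); first by rewrite expr1n.
by rewrite expr0n.
Qed.

Lemma L2_subgroup_indic : L2 m chi.
Proof.
split; first by split; [exact: measurable_indic|exact: measurable_cst].
under eq_integral do rewrite csq_subgroup_indic.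
by rewrite integral_indic// setIT.
Qed.

Lemma subgroup_indic_neq0 : ~ ae_eq m setT chi (cst 0).
Proof.
move=> h; have : m.-negligible KB.
  apply: negligibleS h => y Ky /= /(_ I) [].
  by rewrite indicE mem_set// => /eqP; rewrite oner_eq0.
by move=> /(measure_negligible mK) mK00; move: mK0; rewrite mK00 ltxx.
Qed.

Lemma subgroup_indic_translate x : K x -> translate x chi = chi.
Proof.
move=> Kx; apply/funext => y; rewrite /translate /chi !indicE.
congr (Complex ((_ : bool)%:R) 0).
apply/idP/idP; rewrite !inE => h; last by apply: KD => //; exact: KN.
by have := KD Kx h; rewrite addNKr.
Qed.

Let Lchi := L2_subgroup_indic.

Lemma gabor_subgroup_out x c : ~ K x -> gabor m chi chi x c = 0.
Proof.
move=> Kx; rewrite /gabor; have -> : (fun y : borel G =>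
    chi y * conjc (chi (- x + (y : G))) * c (- (y : G))) = (fun=> 0).
  apply/funext => y; rewrite /chi !indicE.
  case: (boolP (y \in KB)) => [|_]; last by rewrite mul0r mul0r.
  rewrite inE => Ky; case: (boolP (_ \in KB)) => [|_]; last first.
    rewrite (_ : conjc _ = 0) ?mulr0 ?mul0r//.
    by apply: complexP; rewrite ?complex_partsE//= oppr0.
  rewrite inE => Kxy; exfalso; apply: Kx.
  by have := KD Ky (KN Kxy); rewrite opprD opprK addrCA subrr addr0.
by rewrite /cintegral /= /Rintegral integral0.
Qed.

Lemma gabor_subgroup_in x c : K x -> gabor m chi chi x c = gabor m chi chi 0 c.
Proof.
move=> Kx; rewrite !gaborE; congr (L2dot m _ _); apply/funext => y.
by rewrite /atom !subgroup_indic_translate.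
Qed.

(** Translating by [t] in [K] leaves the integral of [c] over [K] unchanged and
    multiplies it by [c t]. *)
Lemma gabor_subgroup_trivial c t : gabor m chi chi 0 c != 0 -> K t -> c t = 1.
Proof.
move=> V0 Kt; have := gabor_translate haar_m t c t Lchi Lchi.
rewrite addNr subgroup_indic_translate// (gabor_subgroup_in c Kt).
rewrite character_opp conjcK => E.
by apply: (mulIf V0); rewrite mul1r -E.
Qed.

Lemma csq_gabor_subgroup c : gabor m chi chi 0 c != 0 ->
  csq (gabor m chi chi 0 c) = fine (m KB) ^+ 2.
Proof.
move=> V0; rewrite /gabor.
have -> : (fun y : borel G => chi y * conjc (chi (- 0 + (y : G))) * c (- (y : G))) = chi.
  apply/funext => y; rewrite oppr0 add0r character_opp /chi indicE.
  case: (boolP (y \in KB)); last by rewrite !mul0r.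
  rewrite inE => Ky; rewrite (gabor_subgroup_trivial V0 Ky).
  by apply: complexP; rewrite !complex_partsE /=; ring.
rewrite csqE /= {1}/Rintegral integral_indic// setIT.
by rewrite /Rintegral integral0 /= expr0n addr0.
Qed.

(** The support is [K] times the section at [0], where the transform has constant
    modulus [m K]; by Plancherel it is square integrable there, so the section has
    finite measure. *)
Lemma not_gabor_qup : ~ gabor_qup m mu.
Proof.
have haar_mu : haar_measure mu by case: plancherel_mu.
have hH : hausdorff_space (character R G) by exact: character_hausdorff.
move=> /(_ chi chi Lchi (conj Lchi subgroup_indic_neq0)) qup.
apply: subgroup_indic_neq0; apply: qup.
pose S : set (G * character R G) := [set z | gabor m chi chi z.1 z.2 != 0].
have oS : open S by exact: (gabor_open hG sG lG haar_m Lchi Lchi).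
pose W := mu (xsection S 0).
have mS : measurable (xsection S 0 : set (borel (character R G))).
  by apply: open_borel; exact: open_section.
have W0 : (0 <= W)%E by exact: measure_ge0.
have Woo : (W < +oo)%E.
  have sE : energy_at m chi chi 0 = m KB.
    rewrite /energy_at (subgroup_indic_translate K0).
    under eq_integral do rewrite csq_subgroup_indic.
    transitivity (\int[m]_y (\1_KB y)%:E)%E; last by rewrite integral_indic// setIT.
    apply: eq_integral => y _; by rewrite indicE; case: (_ \in _); rewrite ?mulr1 ?mulr0.
  have := gabor_energy_at hG sG lG haar_m plancherel_mu (x := 0) Lchi Lchi.
  rewrite sE => /(_ mKoo) E.
  have q0 : 0 < fine (m KB) ^+ 2 by rewrite exprn_gt0// fine_gt0// mK0.
  have : ((fine (m KB) ^+ 2)%:E * W <= m KB)%E.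
    pose XS := xsection S 0 : set (borel (character R G)).
    have -> : ((fine (m KB) ^+ 2)%:E * W =
        \int[mu]_c ((fine (m KB) ^+ 2)%:E * (\1_XS c)%:E))%E.
      rewrite ge0_integralZl_EFin ?ltW//; first by rewrite integral_indic// setIT.
      by apply/measurable_EFinP; exact: measurable_indic.
    rewrite -[leRHS]E; apply: ge0_le_integral => //.
    - by apply: measurable_funeM; apply/measurable_EFinP; exact: measurable_indic.
    - apply/measurable_EFinP/measurable_csq.
      exact: (gabor_cmeasurable hG sG lG haar_m 0 Lchi Lchi).
    - move=> c _; rewrite indicE; case: (boolP (_ \in _)) => [|_]; last first.
        by rewrite mule0 lee_fin csq_ge0.
      by rewrite inE => /xsectionP V0; rewrite mule1 csq_gabor_subgroup.
  move=> /le_lt_trans/(_ mKoo) h; rewrite ltNge leye_eq.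
  by apply/negP => /eqP Wy; move: h; rewrite Wy gt0_muley ?lte_fin.
rewrite (_ : product_measure1 _ _ _ = \int[m]_x ((\1_KB x)%:E * W))%E.
  rewrite ge0_integralZr//; last by apply/measurable_EFinP; exact: measurable_indic.
  by rewrite integral_indic// setIT lte_mul_pinfty.
rewrite /product_measure1; apply: eq_integral => x _ /=.
rewrite indicE; case: (boolP (x \in KB)).
  rewrite inE => Kx; rewrite mul1e /W; congr (mu _).
  apply/seteqP; split=> c /xsectionP /= h; apply/xsectionP; move: h;
    by rewrite /S /= gabor_subgroup_in.
rewrite notin_setE => Kx; rewrite mul0e (_ : xsection _ _ = set0) ?measure0//.
by rewrite -subset0 => c /xsectionP /=; rewrite gabor_subgroup_out// eqxx.
Qed.

End CompactOpenSubgroup.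

End CompactComponent.

Theorem theorem3p5 (R : realType) (G : topologicalZmodType)
    (hausdorffG : hausdorff_space G)
    (second_countableG : @second_countable G)
    (locally_compactG : locally_compact [set: G])
    (m : {measure set (borel G) -> \bar R})
    (haar_m : haar_measure m)
    (mu : {measure set (borel (character R G)) -> \bar R})
    (plancherel_mu : plancherel_measure m mu) :
  gabor_qup m mu <-> ~ compact (identity_component G).
Proof.
split=> [qup cG|ncG]; last exact: noncompact_gabor_qup.
have [K [cK oK K0 KD KN]] := compact_open_subgroup hausdorffG locally_compactG cG.
exact: (not_gabor_qup hausdorffG second_countableG locally_compactG haar_m
  plancherel_mu cK oK K0 KD KN qup).
Qed.
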